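(* The set of $l^2$-Betti numbers arising from finitely generated groups is equal to the set of non-negative real numbers. That is, the union of the sets $\mathcal C(G)$ over all finitely generated groups $G$ equals $[0,\infty)$.
   Context: For a countable discrete group $G$, the rational group ring $\mathbb Q G$ acts on $l^2G$ by convolution, and $M_k(\mathbb Q G)$ acts correspondingly on $(l^2G)^k$. The trace $\tau_G$ on $\mathbb Q G$ is $\tau_G(T)=\langle T\zeta_e,\zeta_e\rangle$, where $\zeta_e\in l^2G$ is the basis vector of the neutral element; the induced trace on $M_k(\mathbb Q G)\cong M_k(\mathbb Q)\otimes \mathbb Q G$ is $\operatorname{tr}\otimes\tau_G$ (with $\operatorname{tr}$ the non-normalized matrix trace), also denoted $\tau_G$, and extended to the weak closure. For self-adjoint $T\in M_k(\mathbb Q G)$, $\dim_{vN}\ker T$ is $\tau_G$ of the orthogonal projection onto $\ker T$. For general $T$, $\dim_{vN}\ker T:=\dim_{vN}\ker T^*T$. A real number $r$ is an $l^2$-Betti number arising from $G$ if there are $k$ and $T\in M_k(\mathbb Q G)$ with $\dim_{vN}\ker T=r$; the set of all such $r$ is $\mathcal C(G)$. *)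

(* Defs.v *)
From HB Require Import structures.
From mathcomp Require Import all_boot all_order all_algebra finmap.
From mathcomp Require Import monalg complex.
From mathcomp Require Import all_classical all_reals.
From mathcomp Require Import topology normedtype esum.
From mathcomp Require showcase.summability.

Set Implicit Arguments.
Unset Strict Implicit.
Unset Printing Implicit Defensive.

Import Order.TTheory GRing.Theory Num.Theory.
Import numFieldNormedType.Exports.

Local Open Scope classical_set_scope.
Local Open Scope ring_scope.

Definition finitely_generated (G : groupType) : Prop :=
  exists s : seq G, forall H : {pred G},
    group_closed H -> {subset s <= H} -> forall g : G, g \in H.

(* The multiplication of [{malg _[_]}] in monalg is only available for monoids
   in which [x * y = 1] forces [x = y = 1], hence never for nontrivial groups;
   the same convolution product is put here on an alias. *)
Definition group_ring (G : groupType) : Type := {malg rat[G]}.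

Section GroupRing.
Variable G : groupType.
Implicit Types (a b c : group_ring G) (g h : G) (x y : rat).

HB.instance Definition _ := GRing.Zmodule.copy (group_ring G) {malg rat[G]}.

Definition gr_one : group_ring G := mkmalgU 1%g 1.

Definition gr_mul a b : group_ring G :=
  \sum_(h <- msupp a) \sum_(g <- msupp b) mkmalgU (h * g)%g (a@_h * b@_g).

(* The involution: the coefficients are rational, so no conjugation occurs. *)
Definition gr_star a : group_ring G :=
  \sum_(h <- msupp a) mkmalgU h^-1%g a@_h.

Let gr_mulEw (d1 d2 : {fset G}) a b :
  (msupp a `<=` d1)%fset -> (msupp b `<=` d2)%fset ->
  gr_mul a b = \sum_(h <- d1) \sum_(g <- d2) mkmalgU (h * g)%g (a@_h * b@_g).
Proof.
move=> le1 le2; rewrite /gr_mul (big_fset_incl _ le1) /=; last first.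
  move=> h _ /mcoeff_outdom ah.
  by rewrite big1 // => g _; rewrite ah mul0r monalgU0.
apply/eq_bigr=> h _; apply/big_fset_incl => // g _ /mcoeff_outdom ->.
by rewrite mulr0 monalgU0.
Qed.

Let gr_mul0l : left_zero 0 gr_mul.
Proof. by move=> a; rewrite /gr_mul msupp0 big_seq_fset0. Qed.

Let gr_mul0r : right_zero 0 gr_mul.
Proof.
by move=> a; rewrite /gr_mul big1 // => h _; rewrite msupp0 big_seq_fset0.
Qed.

Let gr_mulUl x h b :
  gr_mul (mkmalgU h x) b = \sum_(g <- msupp b) mkmalgU (h * g)%g (x * b@_g).
Proof.
rewrite (gr_mulEw msuppU_le (fsubset_refl _)) big_seq_fset1.
by apply/eq_bigr => g _; rewrite mcoeffUU.
Qed.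

Let gr_mulUr x g a :
  gr_mul a (mkmalgU g x) = \sum_(h <- msupp a) mkmalgU (h * g)%g (a@_h * x).
Proof.
rewrite (gr_mulEw (fsubset_refl _) msuppU_le); apply/eq_bigr => h _.
by rewrite big_seq_fset1 mcoeffUU.
Qed.

Let gr_mulUU x y h g :
  gr_mul (mkmalgU h x) (mkmalgU g y) = mkmalgU (h * g)%g (x * y).
Proof. by rewrite (gr_mulEw msuppU_le msuppU_le) !big_seq_fset1 !mcoeffUU. Qed.

Let gr_mul1l : left_id gr_one gr_mul.
Proof.
move=> a; rewrite gr_mulUl [RHS]monalgE.
by apply/eq_bigr=> g _; rewrite mul1r mul1g.
Qed.

Let gr_mul1r : right_id gr_one gr_mul.
Proof.
move=> a; rewrite gr_mulUr [RHS]monalgE.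
by apply/eq_bigr=> g _; rewrite mulr1 mulg1.
Qed.

Let gr_mulDl : left_distributive gr_mul +%R.
Proof.
move=> a b c.
rewrite [in RHS](gr_mulEw (fsubsetUl _ (msupp b)) (fsubset_refl _)).
rewrite [in RHS](gr_mulEw (fsubsetUr (msupp a) _) (fsubset_refl _)).
rewrite (gr_mulEw (msuppD_le _ _) (fsubset_refl _)).
rewrite -big_split /=; apply/eq_bigr=> h _.
rewrite -big_split /=; apply/eq_bigr=> g _.
by rewrite mcoeffD mulrDl monalgUD.
Qed.

Let gr_mulDr : right_distributive gr_mul +%R.
Proof.
move=> c a b.
rewrite [in RHS](gr_mulEw (fsubset_refl _) (fsubsetUl _ (msupp b))).
rewrite [in RHS](gr_mulEw (fsubset_refl _) (fsubsetUr (msupp a) _)).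
rewrite (gr_mulEw (fsubset_refl _) (msuppD_le _ _)).
rewrite -big_split /=; apply/eq_bigr=> h _.
rewrite -big_split /=; apply/eq_bigr=> g _.
by rewrite mcoeffD mulrDr monalgUD.
Qed.

Let gr_mulA : associative gr_mul.
Proof.
have El a b : gr_mul a b = \sum_(h <- msupp a) gr_mul (mkmalgU h a@_h) b.
  by apply/eq_bigr=> h _; rewrite gr_mulUl.
have Er a b : gr_mul a b = \sum_(g <- msupp b) gr_mul a (mkmalgU g b@_g).
  rewrite /gr_mul exchange_big; apply/eq_bigr=> g _.
  by rewrite -/(gr_mul _ _) gr_mulUr.
move=> a b c.
rewrite [RHS](big_morph (gr_mul^~ _) (fun _ _ => gr_mulDl _ _ _) (gr_mul0l _)).
rewrite El; apply/eq_bigr=> h _.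
rewrite [LHS](big_morph (gr_mul _) (fun _ _ => gr_mulDr _ _ _) (gr_mul0r _)).
rewrite [RHS](big_morph (gr_mul^~ _) (fun _ _ => gr_mulDl _ _ _) (gr_mul0l _)).
apply/eq_bigr=> g _.
rewrite [LHS](big_morph (gr_mul _) (fun _ _ => gr_mulDr _ _ _) (gr_mul0r _)).
by rewrite Er; apply/eq_bigr=> k _; rewrite !gr_mulUU mulrA mulgA.
Qed.

Let gr_one_neq0 : gr_one != 0.
Proof. by rewrite monalgU_eq0 oner_eq0. Qed.

HB.instance Definition _ := GRing.Zmodule_isNzRing.Build (group_ring G)
  gr_mulA gr_mul1l gr_mul1r gr_mulDl gr_mulDr gr_one_neq0.

End GroupRing.

Section L2.
Variables (R : realType) (G : groupType).
Implicit Types (f : G -> R[i]) (k : nat).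

Definition l2 : set (G -> R[i]) :=
  [set f | (\esum_(g in [set: G]) (ComplexField.Normc.normc (f g) ^+ 2)%:E < +oo)%E].

Definition l2_dot (f1 f2 : G -> R[i]) : R[i] :=
  summability.sum (fun g => f1 g * (f2 g)^* : R[i]^o).

Definition l2_basis (g : G) : G -> R[i] := fun h => (h == g)%:R.

Definition l2k k : set ('I_k -> G -> R[i]) := [set xi | forall i, l2 (xi i)].

Definition l2k_dot k (xi eta : 'I_k -> G -> R[i]) : R[i] :=
  \sum_i l2_dot (xi i) (eta i).

(* The orthogonal projection of [xi] onto [V] is the point [p] of [V] such that
   [xi - p] is orthogonal to [V]; it exists and is unique for [xi] in [l2k]
   when [V] is a closed subspace of [l2k]. *)
Definition orth_proj k (V : set ('I_k -> G -> R[i])) (xi : 'I_k -> G -> R[i]) :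
    'I_k -> G -> R[i] :=
  xget 0 [set p | V p /\ forall v, V v -> l2k_dot (xi - p) v = 0].

Definition gr_act (a : group_ring G) f : G -> R[i] :=
  fun g => \sum_(h <- msupp a) ratr a@_h * f (h^-1 * g)%g.

Definition mx_act k (T : 'M[group_ring G]_k) (xi : 'I_k -> G -> R[i]) :
    'I_k -> G -> R[i] :=
  fun i => \sum_j gr_act (T i j) (xi j).

Definition mx_ker k (T : 'M[group_ring G]_k) : set ('I_k -> G -> R[i]) :=
  [set xi | l2k xi /\ mx_act T xi = 0].

(* The traces are defined by their formulas on arbitrary maps, so that they
   apply to the operators of the weak closure. *)
Definition vn_trace1 (S : (G -> R[i]) -> (G -> R[i])) : R[i] :=
  l2_dot (S (l2_basis 1%g)) (l2_basis 1%g).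

Definition op_entry k (P : ('I_k -> G -> R[i]) -> ('I_k -> G -> R[i]))
    (i j : 'I_k) : (G -> R[i]) -> (G -> R[i]) :=
  fun f => P (fun l => if l == j then f else 0) i.

Definition vn_trace k (P : ('I_k -> G -> R[i]) -> ('I_k -> G -> R[i])) : R[i] :=
  \sum_i vn_trace1 (op_entry P i i).

Definition mx_star k (T : 'M[group_ring G]_k) : 'M[group_ring G]_k :=
  map_mx (@gr_star G) T^T.

Definition vn_dim_ker_sa k (T : 'M[group_ring G]_k) : R[i] :=
  vn_trace (orth_proj (mx_ker T)).

Definition vn_dim_ker k (T : 'M[group_ring G]_k) : R[i] :=
  vn_dim_ker_sa (mx_star T *m T).

Definition l2_betti_numbers : set R :=
  [set r | exists k (T : 'M[group_ring G]_k),
     (0 < k)%N /\ vn_dim_ker T = r%:C%C].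

End L2.

Arguments l2_betti_numbers R G : clear implicits.

(* Main.v *)
(* For every set I of natural numbers a group G_I is built, generated by a
   translation t, a central involution z and three involutions: a break lamp, a
   start lamp and an end lamp. Translates of distinct lamps commute, except that
   the start lamp at i and the end lamp at i + n have commutator z when n is not
   in I. The spectral projections of the break lamps are independent and cut the
   line into finite chains, a chain of n steps starting at a given position with
   probability 2^-(n+2). Consider the vectors v with z v = -v that are constant
   along the chains (v = t v wherever there is no break), fixed by the start lamp
   at the first position of each chain and by the end lamp at the last one. Each
   of these conditions says that an element B of the group ring kills v, and
   together they define the kernel of the sum of the B^* B. On a chain of n steps
   the two lamp conditions are independent if n is in I; otherwise the lamps
   anticommute on v and force v = 0 there. Hence the kernel has dimension
   \sum_(n in I) 2^-(n+5), which takes all values in [0, 1/16] as I varies, and a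
   scalar matrix of size k multiplies the dimension by k. *)
Require Import Defs.
From HB Require Import structures.
From mathcomp Require Import all_boot all_order all_algebra finmap.
From mathcomp Require Import monalg complex.
From mathcomp Require Import all_classical all_reals.
From mathcomp Require Import topology ereal normedtype sequences esum.
From mathcomp Require Import ring lra zify.
From mathcomp Require showcase.summability.

Set Implicit Arguments.
Unset Strict Implicit.
Unset Printing Implicit Defensive.

Import Order.TTheory GRing.Theory Num.Theory.
Import numFieldNormedType.Exports.

Local Open Scope classical_set_scope.
Local Open Scope ring_scope.

(** A finitely generated group is countable, and so is its rational group ring; each such group
    yields only countably many dimensions. Hence a whole family of groups is needed, and the set I
    ([eps n] says that n is in I) carries the real parameter. Infinitely many commutators can be
    prescribed with finitely many generators because they depend only on the difference of two
    positions. The kernel projection lies only in a weak closure, so it is approached by elements of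
    the group ring. For each n the projection on the kernel vectors living on chains of n steps is
    such an element; let W_N be the sum over n < N. The operator kills W_N. That nothing else is in
    the kernel is pure algebra: modulo the left ideal of elements killing a kernel vector, 1 - W_N
    equals the projection L_N on the configurations whose chain through the origin has at least N
    steps, and the trace of L_N tends to 0. In the exponent n + 5, the chain accounts for n + 2 (n
    unbroken steps and two breaks), and the condition z = -1 and the two lamps for one each. A chain
    has n + 1 positions but carries one constant vector, so it is counted once. *)

Local Notation normc := ComplexField.Normc.normc.
Local Notation psum := summability.partial_sum.
Local Notation totally := summability.totally.
#[local] Existing Instance summability.totally_filter.

(** * Unordered sums of real and complex families *)

Section UnorderedSums.
Variables (R : realType) (I : choiceType).
Implicit Types (f : I -> R) (x y : I -> R[i]) (F : {fset I}).

Lemma psumE (V : zmodType) (x : I -> V) F : psum x F = \sum_(i <- F) x i.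
Proof. by rewrite /psum [RHS]big_seq_fsetE. Qed.

Lemma ler_sum_fsubset f F F' : (F `<=` F')%fset -> (forall i, 0 <= f i) ->
  \sum_(i <- F) f i <= \sum_(i <- F') f i.
Proof.
move=> FF' f0; pose g i := if i \in F then f i else 0.
rewrite (_ : \sum_(i <- F) f i = \sum_(i <- F) g i); last first.
  by rewrite big_seq [RHS]big_seq; apply: eq_bigr => i; rewrite /g => ->.
rewrite (big_fset_incl _ FF') => [|i _ /negPf]; last by rewrite /g => ->.
by apply: ler_sum => i _; rewrite /g; case: ifP.
Qed.

Lemma cvg_psum_ge0 f M : (forall i, 0 <= f i) ->
  (forall F, \sum_(i <- F) f i <= M) ->
  exists s : R, psum f @ totally --> s.
Proof.
move=> f0 fM; pose S := [set \sum_(i <- F) f i | F in [set: {fset I}]].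
have Ssup : has_sup S.
  split; first by exists (\sum_(i <- fset0) f i); exists fset0.
  by exists M => _ [F _ <-].
exists (sup S); apply/cvgrPdist_le => e e0.
have [_ [F0 _ <-] ltF0] := sup_adherent e0 Ssup.
exists F0 => //= F F0F; rewrite psumE ger0_norm ?subr_ge0; last first.
  by apply: ub_le_sup => //; [case: Ssup | exists F].
rewrite lerBlDl -lerBlDr; apply: le_trans (ltW ltF0) _.
exact: ler_sum_fsubset.
Qed.

Lemma normcE (z : R[i]) : `|z| = (normc z)%:C%C.
Proof. by rewrite normc_def; case: z. Qed.

Lemma normc_ge0 (z : R[i]) : 0 <= normc z.
Proof. by rewrite -ler0c -normcE. Qed.

Lemma normcr (r : R) : normc r%:C%C = `|r|.
Proof. by rewrite /= expr0n addr0 sqrtr_sqr. Qed.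

Lemma Re_le_normc (z : R[i]) : `|complex.Re z| <= normc z.
Proof.
by case: z => a b /=; rewrite -sqrtr_sqr ler_wsqrtr // lerDl sqr_ge0.
Qed.

Lemma Im_le_normc (z : R[i]) : `|complex.Im z| <= normc z.
Proof.
by case: z => a b /=; rewrite -sqrtr_sqr ler_wsqrtr // lerDr sqr_ge0.
Qed.

Lemma cvg_real_complex (T : Type) (Fl : set_system T) {FF : Filter Fl}
    (g : T -> R) (l : R) :
  g @ Fl --> l -> (fun t => (g t)%:C%C : R[i]^o) @ Fl --> (l%:C%C : R[i]^o).
Proof.
move=> gl; apply/cvgrPdist_lt => e e0.
have eE : e = (complex.Re e)%:C%C.
  by rewrite RRe_real // ger0_real // ltW.
have e0' : 0 < complex.Re e by move: e0; rewrite {1}eE ltcR.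
move/cvgrPdist_lt: gl => /(_ _ e0'); apply: filterS => t.
by rewrite -rmorphB /= normcE normcr [in X in _ -> X]eE ltcR.
Qed.

(** The positive and negative parts of [f] are nonnegative and dominated by its absolute value, so
    the monotone case applies to each. *)
Lemma cvg_psum_abs f (M : R) : (forall F, \sum_(i <- F) `|f i| <= M) ->
  exists s : R, psum f @ totally --> s.
Proof.
move=> fM.
have [s1] : exists s : R, psum (fun i => (`|f i| + f i) / 2) @ totally --> s.
  apply: (@cvg_psum_ge0 _ M) => [i|F].
    by rewrite divr_ge0 // -lerBlDr sub0r -normrN ler_norm.
  apply: le_trans (fM F); apply: ler_sum => i _.
  by rewrite ler_pdivrMr // mulr_natr mulr2n lerD2l ler_norm.
have [s2 h2 h1] : exists s : R, psum (fun i => (`|f i| - f i) / 2) @ totally --> s.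
  apply: (@cvg_psum_ge0 _ M) => [i|F].
    by rewrite divr_ge0 // subr_ge0 ler_norm.
  apply: le_trans (fM F); apply: ler_sum => i _.
  by rewrite ler_pdivrMr // mulr_natr mulr2n lerD2l -normrN ler_norm.
exists (s1 - s2).
rewrite (_ : psum f = psum (fun i => (`|f i| + f i) / 2) \- psum (fun i => (`|f i| - f i) / 2)).
  exact: cvgB.
apply/funext => F /=; rewrite !psumE -sumrB; by apply: eq_bigr => i _; lra.
Qed.

Definition has_csum x (s : R[i]) := psum x @ totally --> (s : R[i]^o).

Lemma has_csum_ex x (M : R) : (forall F, \sum_(i <- F) normc (x i) <= M) ->
  exists s, has_csum x s.
Proof.
move=> xM.
have [a ha] : exists s : R, psum (fun i => complex.Re (x i)) @ totally --> s.
  apply: (@cvg_psum_abs _ M) => F; apply: le_trans (xM F).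
  by apply: ler_sum => i _; exact: Re_le_normc.
have [b hb] : exists s : R, psum (fun i => complex.Im (x i)) @ totally --> s.
  apply: (@cvg_psum_abs _ M) => F; apply: le_trans (xM F).
  by apply: ler_sum => i _; exact: Im_le_normc.
exists (a%:C%C + 'i%C * b%:C%C); rewrite /has_csum.
rewrite (_ : psum x = (fun F => (psum (fun i => complex.Re (x i)) F)%:C%C : R[i]^o)
   \+ (fun F => 'i%C * (psum (fun i => complex.Im (x i)) F)%:C%C : R[i]^o)).
  have FF : Filter (@totally I) by exact: filter_filter.
  have h1 := @cvg_real_complex _ _ FF _ _ ha.
  have h2 := @cvgMr R[i] _ totally FF _ 'i%C _ (@cvg_real_complex _ _ FF _ _ hb).
  exact: (@cvgD R[i] R[i]^o _ totally FF _ _ _ _ h1 h2).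
apply/funext => F /=; rewrite !psumE !rmorph_sum /= mulr_sumr -big_split /=.
by apply: eq_bigr => i _; exact: complexE.
Qed.

Lemma has_csumP x s : has_csum x s -> summability.sum (x : I -> R[i]^o) = s.
Proof.
move=> h; apply: (@cvg_lim R[i]^o _ _ totally) h.
exact: norm_hausdorff.
Qed.

End UnorderedSums.

Section ComplexSums.
Variables (R : realType) (I : choiceType).
Implicit Types (f : I -> R) (x y : I -> R[i]) (F : {fset I}).

Lemma normc_zero : normc (0 : R[i]) = 0.
Proof. by rewrite -[0]/(0%:C%C) normcr normr0. Qed.

Lemma le_normcD (a b : R[i]) : normc (a + b) <= normc a + normc b.
Proof. by rewrite -lecR rmorphD /= -!normcE ler_normD. Qed.

Lemma normcM (a b : R[i]) : normc (a * b) = normc a * normc b.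
Proof. by apply: complexI; rewrite rmorphM /= -!normcE normrM. Qed.

Lemma normc_conj (a : R[i]) : normc a^* = normc a.
Proof. by apply: complexI; rewrite -!normcE norm_conjC. Qed.

Lemma normc_sum (r : seq I) x : normc (\sum_(i <- r) x i) <= \sum_(i <- r) normc (x i).
Proof.
elim: r => [|i r IHr]; first by rewrite !big_nil normc_zero.
by rewrite !big_cons (le_trans (le_normcD _ _)) // lerD2l.
Qed.

(** Trades the filter and the complex-valued norm for real epsilons and finite sets; the algebra of
    sums below works in this form. *)
Lemma has_csumE x s : has_csum x s <->
  forall e : R, 0 < e -> exists F0, forall F, (F0 `<=` F)%fset ->
    normc (s - \sum_(i <- F) x i) <= e.
Proof.
have FF : Filter (@totally I) by exact: filter_filter.
have key := @cvgrPdist_le R[i] R[i]^o _ totally FF (psum x) s.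
split=> [/key h e e0|h].
  have e0' : 0 < e%:C%C by rewrite ltcR.
  have [F0 _ hF] := h _ e0'; exists F0 => F F0F.
  by rewrite -lecR -normcE -psumE; exact: hF.
apply/key => e e0.
have eE : e = (complex.Re e)%:C%C by rewrite RRe_real // ger0_real // ltW.
have e0' : 0 < complex.Re e by move: e0; rewrite {1}eE ltcR.
have [F0 hF] := h _ e0'; exists F0 => //= F F0F.
by rewrite psumE [X in X <= _]normcE eE lecR; exact: hF.
Qed.

Lemma has_csum_unique x s s' : has_csum x s -> has_csum x s' -> s = s'.
Proof. by move=> /has_csumP <- /has_csumP. Qed.

Lemma eq_has_csum x y s : x =1 y -> has_csum x s -> has_csum y s.
Proof. by move=> /funext ->. Qed.

Lemma has_csumD x y s s' : has_csum x s -> has_csum y s' ->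
  has_csum (fun i => x i + y i) (s + s').
Proof.
move=> /has_csumE hx /has_csumE hy; apply/has_csumE => e e0.
have e20 : 0 < e / 2 by rewrite divr_gt0.
have [F1 h1] := hx _ e20; have [F2 h2] := hy _ e20.
exists (F1 `|` F2)%fset => F; rewrite fsubUset => /andP[F1F F2F].
rewrite big_split /= opprD addrACA (le_trans (le_normcD _ _)) //.
by rewrite [e]splitr lerD ?h1 ?h2.
Qed.

Lemma has_csumZ (a : R[i]) x s : has_csum x s -> has_csum (fun i => a * x i) (a * s).
Proof.
move=> /has_csumE hx; apply/has_csumE => e e0.
have n0 : 0 < normc a + 1 by rewrite ltr_wpDl ?normc_ge0.
have [F0 hF] := hx (e / (normc a + 1)) (divr_gt0 e0 n0).
exists F0 => F F0F; rewrite -mulr_sumr -mulrBr normcM.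
apply: (@le_trans _ _ ((normc a + 1) * normc (s - \sum_(i <- F) x i))).
  by rewrite ler_wpM2r ?normc_ge0 // lerDl.
by rewrite mulrC -ler_pdivlMr //; exact: hF.
Qed.

Lemma has_csumN x s : has_csum x s -> has_csum (fun i => - x i) (- s).
Proof.
move/(@has_csumZ (-1)); rewrite mulN1r; apply: eq_has_csum => i.
by rewrite mulN1r.
Qed.

Lemma has_csum_conj x s : has_csum x s -> has_csum (fun i => (x i)^*) s^*.
Proof.
move=> /has_csumE hx; apply/has_csumE => e /hx [F0 hF]; exists F0 => F F0F.
by rewrite -rmorph_sum -rmorphB /= normc_conj; exact: hF.
Qed.

Lemma has_csum_sum (J : Type) (r : seq J) (x : J -> I -> R[i]) (s : J -> R[i]) :
  (forall j, has_csum (x j) (s j)) ->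
  has_csum (fun i => \sum_(j <- r) x j i) (\sum_(j <- r) s j).
Proof.
move=> h; elim: r => [|j r IHr].
  rewrite big_nil; apply/has_csumE => e e0; exists fset0 => F _.
  rewrite big1 ?subrr; last by move=> i _; rewrite big_nil.
  by rewrite normc_zero ltW.
rewrite big_cons; apply: eq_has_csum (has_csumD (h j) IHr) => i.
by rewrite big_cons.
Qed.

Lemma has_csum_reindex (h h' : I -> I) x s : cancel h h' -> cancel h' h ->
  has_csum x s -> has_csum (fun i => x (h i)) s.
Proof.
move=> hK h'K /has_csumE hx; apply/has_csumE => e /hx [F0 hF].
exists [fset h' i | i in F0]%fset => F F0F.
have -> : \sum_(i <- F) x (h i) = \sum_(i <- [fset h i | i in F]%fset) x i.
  by rewrite big_imfset //= => i j _ _; exact: (can_inj hK).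
apply: hF; apply/fsubsetP => i iF0; rewrite -(h'K i).
by apply: in_imfset; apply: (fsubsetP F0F); exact: in_imfset.
Qed.

Lemma has_csum_fset x F : (forall i, i \notin F -> x i = 0) ->
  has_csum x (\sum_(i <- F) x i).
Proof.
move=> xF; apply/has_csumE => e e0; exists F => F' FF'.
rewrite (big_fset_incl _ FF') => [|i _]; last exact: xF.
by rewrite subrr normc_zero ltW.
Qed.

Lemma has_csum_le x s (M : R) :
  (forall F, \sum_(i <- F) normc (x i) <= M) -> has_csum x s -> normc s <= M.
Proof.
move=> xM /has_csumE h; apply/ler_addgt0Pr => e /h [F0 /(_ _ (fsubset_refl _)) hF].
rewrite -(subrK (\sum_(i <- F0) x i) s) (le_trans (le_normcD _ _)) //.
by rewrite addrC lerD // (le_trans (normc_sum _ _)).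
Qed.

Lemma has_csum_ge0 f s : (forall i, 0 <= f i) ->
  has_csum (fun i => (f i)%:C%C) s ->
  0 <= s /\ forall F, \sum_(i <- F) f i <= complex.Re s.
Proof.
move=> f0 /has_csumE h.
have Im0 : complex.Im s = 0.
  apply/eqP; rewrite -normr_le0; apply/ler_addgt0Pr => e /h.
  move=> [F0 /(_ _ (fsubset_refl _)) hF]; rewrite add0r (le_trans _ hF) //.
  rewrite -rmorph_sum /= (le_trans _ (Im_le_normc _)) //.
  by case: (s) => a b /=; rewrite subr0.
have le_s F : \sum_(i <- F) f i <= complex.Re s.
  apply/ler_addgt0Pr => e /h [F0 /(_ _ (fsubsetUl F0 F)) hF].
  rewrite -lerBlDl; apply: le_trans hF; apply: le_trans (Re_le_normc _).
  rewrite -rmorph_sum /=.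
  apply: (@le_trans _ _ (\sum_(i <- (F0 `|` F)%fset) f i - complex.Re s)).
    by rewrite lerB // ler_sum_fsubset ?fsubsetUr.
  by rewrite -normrN (le_trans _ (ler_norm _)) //; case: (s) => a b /=; rewrite opprB.
split=> //; rewrite lecE /= Im0 eqxx /=.
by have := le_s fset0; rewrite big_nil.
Qed.

End ComplexSums.

(** * The action of the group ring on functions *)

Section GroupRingAction.
Variables (R : realType) (G : groupType).
Implicit Types (a b : group_ring G) (f : G -> R[i]) (g h : G) (x : rat).

Lemma gr_msuppD a b : (msupp (a + b : group_ring G) `<=` msupp a `|` msupp b)%fset.
Proof. exact: msuppD_le. Qed.

Lemma gr_coeffD a b g : (a + b : group_ring G)@_g = a@_g + b@_g.
Proof. exact: mcoeffD. Qed.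

Lemma gr_actEw (d : {fset G}) a f g : (msupp a `<=` d)%fset ->
  gr_act a f g = \sum_(h <- d) ratr a@_h * f (h^-1 * g)%g.
Proof.
move=> ad; rewrite /gr_act (big_fset_incl _ ad) // => h _ /mcoeff_outdom ->.
by rewrite rmorph0 mul0r.
Qed.

Lemma gr_act0 f : gr_act 0 f = 0.
Proof. by apply/funext => g; rewrite /gr_act msupp0 big_seq_fset0. Qed.

Lemma gr_actDl a b f : gr_act (a + b) f = gr_act a f + gr_act b f.
Proof.
apply/funext => g; rewrite [RHS]/GRing.add /=.
rewrite (gr_actEw _ _ (gr_msuppD a b)) (gr_actEw _ _ (fsubsetUl _ (msupp b))).
rewrite (gr_actEw _ _ (fsubsetUr (msupp a) _)).
by rewrite -big_split /=; apply: eq_bigr => h _; rewrite gr_coeffD rmorphD mulrDl.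
Qed.

Lemma gr_act_sum (J : Type) (r : seq J) (F : J -> group_ring G) f :
  gr_act (\sum_(j <- r) F j) f = \sum_(j <- r) gr_act (F j) f.
Proof.
exact: (big_morph (fun a => gr_act a f) (fun a b => gr_actDl a b f) (gr_act0 f)).
Qed.

Lemma gr_actNl a f : gr_act (- a) f = - gr_act a f.
Proof. by apply/eqP; rewrite -addr_eq0 -gr_actDl addNr gr_act0. Qed.

Lemma gr_actBl a b f : gr_act (a - b) f = gr_act a f - gr_act b f.
Proof. by rewrite gr_actDl gr_actNl. Qed.

Lemma gr_actU h x f : gr_act (mkmalgU h x) f = fun g => ratr x * f (h^-1 * g)%g.
Proof.
apply/funext => g.
by rewrite (gr_actEw f g msuppU_le) big_seq_fset1 mcoeffUU.
Qed.

Lemma gr_mulE a b : a * b =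
  \sum_(h <- msupp a) \sum_(g <- msupp b) mkmalgU (h * g)%g (a@_h * b@_g).
Proof. by []. Qed.

Lemma gr_act1 f : gr_act 1 f = f.
Proof.
rewrite -[1]/(mkmalgU 1%g 1) gr_actU; apply/funext => g.
by rewrite rmorph1 mul1r invg1 mul1g.
Qed.

Lemma sum_ffun (J : Type) (r : seq J) (F : J -> G -> R[i]) g :
  (\sum_(j <- r) F j) g = \sum_(j <- r) F j g.
Proof. by elim: r => [|j r IHr]; rewrite ?big_nil // !big_cons -IHr. Qed.

Lemma gr_actM a b f : gr_act (a * b) f = gr_act a (gr_act b f).
Proof.
rewrite gr_mulE gr_act_sum; apply/funext => k; rewrite sum_ffun /gr_act.
apply: eq_bigr => h _; rewrite -/(gr_act _ _ _) gr_act_sum sum_ffun mulr_sumr.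
apply: eq_bigr => g _.
by rewrite gr_actU rmorphM -mulrA invgM mulgA.
Qed.

Lemma gr_actBr a f f' : gr_act a (f - f') = gr_act a f - gr_act a f'.
Proof.
apply/funext => g; rewrite /gr_act /= [RHS]/GRing.add /= [X in _ + X]/GRing.opp /=.
by rewrite -sumrB; apply: eq_bigr => h _; rewrite -mulrBr.
Qed.

Lemma gr_actr0 a : gr_act a (0 : G -> R[i]) = 0.
Proof. by apply/funext => g; rewrite /gr_act big1 // => h _; rewrite mulr0. Qed.

Lemma gr_act_basis a : gr_act a (l2_basis R 1%g) = fun g => ratr a@_g.
Proof.
apply/funext => g; rewrite (gr_actEw _ _ (fsubsetUl (msupp a) [fset g]%fset)).
rewrite (big_fsetD1 g) /=; last by rewrite !inE eqxx orbT.
rewrite mulVg /l2_basis eqxx mulr1 big_seq big1 ?addr0 // => h.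
rewrite !inE => /andP[/negPf hg _].
rewrite -(can_eq (mulKg h)) mulVKg mulg1 eq_sym hg mulr0 //.
Qed.

End GroupRingAction.

(** * The space l2 and its inner product *)

Section L2Theory.
Variables (R : realType) (G : groupType).
Implicit Types (f v : G -> R[i]) (g h : G) (M A B : R) (F : {fset G}).

(** The bound on the squared norm is kept explicit because the limit arguments need its size, not
    only its finiteness. *)
Definition l2_le f M := forall F, \sum_(g <- F) normc (f g) ^+ 2 <= M.

Lemma l2P f : l2 f <-> exists M, l2_le f M.
Proof.
rewrite /l2 /=; set e := esum _ _; split=> [eoo|[M fM]].
  exists (fine e) => F.
  have e0 : (0 <= e)%E by apply: esum_ge0 => g _; rewrite lee_fin sqr_ge0.
  rewrite -lee_fin fineK ?ge0_fin_numE //.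
  apply: esum_ge; exists [set` F] => //.
  by rewrite fsbig_finite //= set_fsetK sumEFin.
apply: (@le_lt_trans _ _ M%:E); last exact: ltry.
apply: ge_ereal_sup => _ [A [finA _] <-].
by rewrite fsbig_finite //= sumEFin lee_fin.
Qed.

Lemma l2_le_ge0 f M : l2_le f M -> 0 <= M.
Proof. by move/(_ fset0); rewrite big_nil. Qed.

Lemma l2_dotP f v : l2 f -> l2 v ->
  has_csum (fun g => f g * (v g)^*) (l2_dot f v).
Proof.
move=> /l2P[A fA] /l2P[B vB].
have [F|s hs] := @has_csum_ex _ _ (fun g => f g * (v g)^*) (A + B).
  apply: le_trans (lerD (fA F) (vB F)); rewrite -big_split /=.
  apply: ler_sum => g _; rewrite normcM normc_conj.
  have := normc_ge0 (f g); have := normc_ge0 (v g).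
  set p := normc _; set q := normc _; move=> p0 q0; nra.
by rewrite /l2_dot (has_csumP hs).
Qed.

Lemma l2_dot_basis f g : l2_dot f (l2_basis R g) = f g.
Proof.
apply: has_csumP.
have := @has_csum_fset _ _ (fun h => f h * (l2_basis R g h)^*) [fset g]%fset.
rewrite big_seq_fset1 /l2_basis eqxx rmorph1 mulr1; apply => h.
by rewrite inE => /negPf ->; rewrite rmorph0 mulr0.
Qed.

Lemma l2_basisP g : l2 (l2_basis R g).
Proof.
apply/l2P; exists 1 => F.
apply: (@le_trans _ _ (\sum_(h <- (g |` F)%fset) normc (l2_basis R g h) ^+ 2)).
  by apply: ler_sum_fsubset => [|i]; rewrite ?fsubsetUr ?sqr_ge0.
rewrite (big_fsetD1 g) ?fset1U1 //= /l2_basis eqxx big_seq big1 ?addr0.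
  by rewrite -[1%:R]/(1%:C%C) normcr normr1 expr1n.
by move=> h; rewrite !inE => /andP[/negPf -> _]; rewrite normc_zero expr0n.
Qed.

Lemma l2D f v : l2 f -> l2 v -> l2 (f + v).
Proof.
move=> /l2P[A fA] /l2P[B vB]; apply/l2P; exists (2 * (A + B)) => F.
apply: (@le_trans _ _ (\sum_(g <- F) 2 * (normc (f g) ^+ 2 + normc (v g) ^+ 2))).
  apply: ler_sum => g _; rewrite [(f + v) g]/GRing.add /=.
  have := le_normcD (f g) (v g); have := normc_ge0 (f g + v g).
  have := normc_ge0 (f g); have := normc_ge0 (v g).
  set p := normc _; set q := normc _; set s := normc _; move=> p0 q0 s0 spq.
  have : s ^+ 2 <= (q + p) ^+ 2 by rewrite ler_sqr ?nnegrE ?addr_ge0.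
  by have := sqr_ge0 (q - p); nra.
by rewrite -mulr_sumr big_split ler_wpM2l // lerD.
Qed.

Lemma l2Z (c : R[i]) f : l2 f -> l2 (fun g => c * f g).
Proof.
move=> /l2P[A fA]; apply/l2P; exists (normc c ^+ 2 * A) => F.
under eq_bigr do rewrite normcM exprMn.
by rewrite -mulr_sumr ler_wpM2l ?sqr_ge0.
Qed.

Lemma l2N f : l2 f -> l2 (- f).
Proof.
move/(@l2Z (-1)); congr l2; apply/funext => g.
by rewrite mulN1r.
Qed.

Lemma l2B f v : l2 f -> l2 v -> l2 (f - v).
Proof. by move=> fl vl; apply: l2D fl (l2N vl). Qed.

Lemma l2_0 : l2 (0 : G -> R[i]).
Proof. by apply/l2P; exists 0 => F; rewrite big1 // => g _; rewrite normc_zero expr0n. Qed.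

Lemma l2_translate h f : l2 f -> l2 (fun g => f (h * g)%g).
Proof.
move=> /l2P[A fA]; apply/l2P; exists A => F.
have := fA [fset (h * g)%g | g in F]%fset.
by rewrite big_imfset //= => g g' _ _; exact: mulgI.
Qed.

Lemma l2_act (a : group_ring G) f : l2 f -> l2 (gr_act a f).
Proof.
move=> fl; rewrite (_ : gr_act a f =
    \sum_(h <- msupp a) (fun g => ratr a@_h * f (h^-1 * g)%g)); last first.
  by apply/funext => g; rewrite sum_ffun.
elim/big_ind: _ => [|u v|h _]; [exact: l2_0 | exact: l2D |].
by apply: l2Z; exact: l2_translate.
Qed.

Lemma l2_dotDl f f' v : l2 f -> l2 f' -> l2 v ->
  l2_dot (f + f') v = l2_dot f v + l2_dot f' v.
Proof.
move=> fl fl' vl; apply: has_csumP.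
apply: eq_has_csum (has_csumD (l2_dotP fl vl) (l2_dotP fl' vl)) => g.
by rewrite -mulrDl.
Qed.

Lemma l2_dotNl f v : l2 f -> l2 v -> l2_dot (- f) v = - l2_dot f v.
Proof.
move=> fl vl; apply: has_csumP.
by apply: eq_has_csum (has_csumN (l2_dotP fl vl)) => g; rewrite -mulNr.
Qed.

Lemma l2_dotBl f f' v : l2 f -> l2 f' -> l2 v ->
  l2_dot (f - f') v = l2_dot f v - l2_dot f' v.
Proof. by move=> fl fl' vl; rewrite l2_dotDl ?l2_dotNl //; exact: l2N. Qed.

Lemma l2_dotC f v : l2 f -> l2 v -> l2_dot v f = (l2_dot f v)^*.
Proof.
move=> fl vl; apply: has_csumP.
apply: eq_has_csum (has_csum_conj (l2_dotP fl vl)) => g.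
by rewrite rmorphM /= conjCK mulrC.
Qed.

Lemma l2_dot_ge0 f : l2 f -> 0 <= l2_dot f f /\ l2_le f (complex.Re (l2_dot f f)).
Proof.
move=> fl; apply: has_csum_ge0 => [g|]; first exact: sqr_ge0.
apply: eq_has_csum (l2_dotP fl fl) => g.
by rewrite -normCK normcE rmorphXn.
Qed.

Lemma l2_dot_eq0 f : l2 f -> l2_dot f f = 0 -> f = 0.
Proof.
move=> /l2_dot_ge0 [_ h] f0; apply/funext => g.
have := h [fset g]%fset; rewrite big_seq_fset1 f0 /= => h'.
apply: ComplexField.Normc.eq0_normc; apply/eqP; rewrite -sqrf_eq0 eq_le h' sqr_ge0 //.
Qed.

(* AM-GM form of the Cauchy-Schwarz inequality. *)
Lemma l2_dot_le f v A B (s : R) : 0 < s -> l2_le f A -> l2_le v B ->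
  normc (l2_dot f v) <= s * A + s^-1 * B.
Proof.
move=> s0 fA vB; have fl : l2 f by apply/l2P; exists A.
have vl : l2 v by apply/l2P; exists B.
apply: has_csum_le (l2_dotP fl vl) => F.
apply: (@le_trans _ _ (\sum_(g <- F) (s * normc (f g) ^+ 2 + s^-1 * normc (v g) ^+ 2))).
  apply: ler_sum => g _; rewrite normcM normc_conj.
  have := normc_ge0 (f g); have := normc_ge0 (v g).
  set p := normc _; set q := normc _; move=> p0 q0.
  rewrite -subr_ge0.
  have -> : s * q ^+ 2 + s^-1 * p ^+ 2 - q * p =
    s^-1 * ((s * q - p / 2) ^+ 2 + 3 / 4 * p ^+ 2) by field; rewrite gt_eqF.
  apply: mulr_ge0; first by rewrite invr_ge0 ltW.
  by apply: addr_ge0; [exact: sqr_ge0 | apply: mulr_ge0; [lra | exact: sqr_ge0]].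
rewrite big_split /= -!mulr_sumr lerD // ler_wpM2l ?invr_ge0 ?(ltW s0) //.
Qed.

(** Left translation is unitary: reindexing the sum moves a translation of [f] to the inverse one of
    [v]. The rest is a finite sum over the support of [a], whose rational coefficients are fixed by
    conjugation. *)
Lemma gr_act_star (a : group_ring G) f v : l2 f -> l2 v ->
  l2_dot (gr_act a f) v = l2_dot f (gr_act (gr_star a) v).
Proof.
move=> fl vl; apply: (has_csum_unique (l2_dotP (l2_act a fl) vl)).
apply: (@eq_has_csum _ _ (fun g => \sum_(h <- msupp a)
    ratr a@_h * (f (h^-1 * g)%g * (v g)^*))) => [g|].
  by rewrite /gr_act mulr_suml; apply: eq_bigr => h _; rewrite mulrA.
rewrite (_ : l2_dot f _ = \sum_(h <- msupp a)
    ratr a@_h * l2_dot f (fun g => v (h * g)%g)); last first.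
  apply: has_csumP; apply: (@eq_has_csum _ _ (fun g => \sum_(h <- msupp a)
    ratr a@_h * (f g * (v (h * g)%g)^*))) => [g|]; last first.
    apply: has_csum_sum => h; apply: has_csumZ; apply: l2_dotP => //.
    exact: l2_translate.
  rewrite /gr_star gr_act_sum sum_ffun rmorph_sum mulr_sumr.
  apply: eq_bigr => h _; rewrite gr_actU invgK rmorphM /= fmorph_rat.
  by rewrite mulrCA.
apply: has_csum_sum => h; apply: has_csumZ.
have := has_csum_reindex (mulKg h^-1)%g (mulVKg h^-1)%g
  (l2_dotP fl (l2_translate h vl)).
by apply: eq_has_csum => g; rewrite mulVKg.
Qed.

End L2Theory.

(** * Orthogonal projections and the dimension of a kernel *)

Section OrthogonalProjection.
Variables (R : realType) (G : groupType) (k : nat).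
Implicit Types (S T : group_ring G) (f v p : G -> R[i]) (i j : 'I_k).

Definition single i f : 'I_k -> G -> R[i] := fun l => if l == i then f else 0.

Lemma l2_dot0l v : l2 v -> l2_dot 0 v = 0.
Proof.
by move=> vl; rewrite -(subrr v) l2_dotBl // subrr.
Qed.

Lemma l2_dot_basisl f g : l2 f -> l2_dot (l2_basis R g) f = (f g)^*.
Proof. by move=> fl; rewrite (l2_dotC fl (l2_basisP _ g)) l2_dot_basis. Qed.

Lemma l2k_dotB (xi eta v : 'I_k -> G -> R[i]) : l2k xi -> l2k eta -> l2k v ->
  l2k_dot (xi - eta) v = l2k_dot xi v - l2k_dot eta v.
Proof.
move=> h1 h2 h3; rewrite /l2k_dot -sumrB; apply: eq_bigr => i _.
exact: l2_dotBl.
Qed.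

Lemma l2k_dot_eq0 (xi : 'I_k -> G -> R[i]) : l2k xi -> l2k_dot xi xi = 0 -> xi = 0.
Proof.
move=> h /eqP; rewrite psumr_eq0 => [/allP h0|i _].
  apply/funext => i; apply: l2_dot_eq0 => //.
  by apply/eqP/h0; rewrite mem_index_enum.
by have [] := l2_dot_ge0 (h i).
Qed.

Lemma l2k_dot_single i f (v : 'I_k -> G -> R[i]) : l2 f -> l2k v ->
  l2k_dot (single i f) v = l2_dot f (v i).
Proof.
move=> fl vl; rewrite /l2k_dot (bigD1 i) //= /single eqxx big1 ?addr0 // => j /negPf ->.
exact: l2_dot0l.
Qed.

Lemma l2k_single i f : l2 f -> l2k (single i f).
Proof. by move=> fl j; rewrite /single; case: ifP => // _; exact: l2_0. Qed.

Lemma vn_trace_orth_projE (V : set ('I_k -> G -> R[i])) :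
  vn_trace (orth_proj V) = \sum_i orth_proj V (single i (l2_basis R 1%g)) i 1%g.
Proof. by apply: eq_bigr => i _; exact: l2_dot_basis. Qed.

(** If p is the projection of the basis vector xi, then xi - p is orthogonal to p itself, so the
    conjugate of [p i 1] is <xi, p> = <p, p>. If there is no projection, [xget] returns its default
    0 and the bound is trivial. *)
Lemma orth_proj_diag_ge0 (V : set ('I_k -> G -> R[i])) i : V `<=` @l2k R G k ->
  0 <= orth_proj V (single i (l2_basis R 1%g)) i 1%g.
Proof.
move=> Vl2; rewrite /orth_proj; case: xgetP => [p _ [Vp orth]|_]; last first.
  exact: lexx.
have pl := Vl2 _ Vp.
have /eqP := orth _ Vp; rewrite l2k_dotB //; last first.
  by apply: l2k_single; exact: l2_basisP.
rewrite l2k_dot_single //; last exact: l2_basisP.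
rewrite l2_dot_basisl // subr_eq0 => /eqP e.
rewrite -(conjCK (p i 1%g)) conjC_ge0 e; apply: sumr_ge0 => j _.
by have [] := l2_dot_ge0 (pl j).
Qed.

Lemma orth_proj_unique (V : set ('I_k -> G -> R[i])) (xi p : 'I_k -> G -> R[i]) :
  V `<=` @l2k R G k -> (forall xi1 xi2, V xi1 -> V xi2 -> V (xi1 - xi2)) -> l2k xi ->
  V p -> (forall xi1, V xi1 -> l2k_dot (xi - p) xi1 = 0) -> orth_proj V xi = p.
Proof.
move=> Vl2 VB xil Vp orth; apply: xget_unique; first by split.
move=> y [Vy orthy]; apply/eqP; rewrite -subr_eq0; apply/eqP.
have Vd := VB _ _ Vy Vp; apply: l2k_dot_eq0; first exact: Vl2.
rewrite l2k_dotB; try exact: Vl2.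
have := orth _ Vd; have := orthy _ Vd; rewrite !l2k_dotB; try exact: Vl2; try exact: xil.
by move=> /subr0_eq <- /subr0_eq <-; rewrite subrr.
Qed.

Lemma mx_ker_l2 (M : 'M[group_ring G]_k) : @mx_ker R G k M `<=` @l2k R G k.
Proof. by move=> xi []. Qed.

Lemma mx_ker_scalar S xi : @mx_ker R G k S%:M xi <->
  forall i, l2 (xi i) /\ gr_act S (xi i) = 0.
Proof.
have actE i : mx_act (S%:M : 'M_k) xi i = gr_act S (xi i).
  rewrite /mx_act (bigD1 i) //= big1 => [|j /negPf ji].
    by rewrite addr0 mxE eqxx.
  by rewrite mxE eq_sym ji gr_act0.
split=> [[l S0] i|h]; first by split; [exact: l | rewrite -actE S0].
by split=> [i|]; [have [] := h i | apply/funext => i; rewrite actE; have [] := h i].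
Qed.

Lemma mx_star_scalar T : mx_star (T%:M : 'M_k) = (gr_star T)%:M.
Proof.
apply/matrixP => i j; rewrite !mxE eq_sym; case: eqP => // _.
by rewrite /gr_star msupp0 big_seq_fset0.
Qed.

(** The hypotheses say that [p0] is the projection of the basis vector of 1 on the kernel in l2. A
    scalar matrix acts on each coordinate separately, so each of the [k] diagonal entries of the
    trace is the value of [p0] at 1. *)
Lemma vn_dim_ker_scalar T p0 : l2 p0 -> gr_act (gr_star T * T) p0 = 0 ->
  (forall v, l2 v -> gr_act (gr_star T * T) v = 0 ->
    l2_dot (l2_basis R 1%g - p0) v = 0) ->
  @vn_dim_ker R G k T%:M = p0 1%g *+ k.
Proof.
move=> p0l Sp0 orth; rewrite /vn_dim_ker /vn_dim_ker_sa mx_star_scalar -scalar_mxM.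
set S := _ * T in Sp0 orth *.
rewrite vn_trace_orth_projE (eq_bigr (fun _ => p0 1%g)) ?sumr_const ?card_ord // => i _.
have -> : orth_proj (mx_ker S%:M) (single i (l2_basis R 1%g)) = single i p0; last first.
  by rewrite /single eqxx.
have sl f : l2 f -> l2k (single i f) by exact: l2k_single.
apply: orth_proj_unique.
- exact: mx_ker_l2.
- move=> u v /mx_ker_scalar hu /mx_ker_scalar hv; apply/mx_ker_scalar => j.
  have [lu Su] := hu j; have [lv Sv] := hv j; split; first exact: l2B.
  by rewrite gr_actBr Su Sv subrr.
- by apply: sl; exact: l2_basisP.
- apply/mx_ker_scalar => j; rewrite /single; case: ifP => _ //.
  by split; [exact: l2_0 | exact: gr_actr0].
move=> v /[dup] Vv /mx_ker_scalar hv; have vl := mx_ker_l2 Vv.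
have bl : l2 (l2_basis R (1%g : G)) by exact: l2_basisP.
rewrite (l2k_dotB (sl _ bl) (sl _ p0l) vl) !l2k_dot_single //.
have [lv Sv] := hv i; rewrite -l2_dotBl //.
exact: orth.
Qed.

(** The squared norm of T v is the inner product of v with T^* T v. *)
Lemma gr_star_kernel T v : l2 v -> gr_act (gr_star T * T) v = 0 -> gr_act T v = 0.
Proof.
move=> vl; rewrite gr_actM => Sv; apply: l2_dot_eq0; first exact: l2_act.
rewrite gr_act_star ?Sv //; last exact: l2_act.
by rewrite (l2_dotC (l2_0 R G) vl) l2_dot0l // rmorph0.
Qed.

End OrthogonalProjection.

Lemma l2_betti_numbers_ge0 (R : realType) (G : groupType) (r : R) :
  l2_betti_numbers R G r -> 0 <= r.
Proof.
move=> [k [T [_ dimT]]]; rewrite -ler0c -dimT /vn_dim_ker /vn_dim_ker_sa.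
rewrite vn_trace_orth_projE; apply: sumr_ge0 => i _.
by apply: orth_proj_diag_ge0; exact: mx_ker_l2.
Qed.

(** * Approximating the kernel projection from the group ring *)

Section L2Limits.
Variables (R : realType) (G : groupType).
Implicit Types (f v : G -> R[i]) (g : G) (F : {fset G}).

Lemma cvg_dist_sqr (u : nat -> R) (e : nat -> R) : e @ \oo --> (0 : R) ->
  (forall N M, (N <= M)%N -> (u M - u N) ^+ 2 <= e N) ->
  exists l : R, u @ \oo --> l.
Proof.
move=> e0 ue; suff : cvg (u @ \oo) by move=> h; exists (lim (u @ \oo)).
apply/cauchy_cvgP/cauchy_exP => d d0.
have d20 : 0 < d ^+ 2 by rewrite exprn_gt0.
have /cvgr0Pnorm_lt/(_ _ d20)[N _ hN] := e0.
exists (u N); exists N => // M /= NM; rewrite /ball /= distrC.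
rewrite -ltr_sqr ?nnegrE ?(ltW d0) // real_normK ?num_real //.
apply: le_lt_trans (ue _ _ NM) _; apply: le_lt_trans (ler_norm _) _.
by apply: hN => /=.
Qed.

Lemma cvg_sum_seq (r : seq G) (u : nat -> G -> R) (l : G -> R) :
  (forall g, u ^~ g @ \oo --> l g) ->
  (fun n => \sum_(g <- r) u n g) @ \oo --> \sum_(g <- r) l g.
Proof.
move=> ul; elim: r => [|g r IHr].
  rewrite big_nil; under eq_fun do rewrite big_nil; exact: cvg_cst.
rewrite big_cons; under eq_fun do rewrite big_cons; exact: cvgD.
Qed.

(* The limit inequality is Fatou's lemma for sums. *)
Lemma l2_complete (u : nat -> G -> R) (e : nat -> R) : e @ \oo --> (0 : R) ->
  (forall N M F, (N <= M)%N -> \sum_(g <- F) (u M g - u N g) ^+ 2 <= e N) ->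
  exists l : G -> R, (forall g, u ^~ g @ \oo --> l g) /\
    forall N F, \sum_(g <- F) (l g - u N g) ^+ 2 <= e N.
Proof.
move=> e0 ue.
have /choice [l ul] : forall g, exists l : R, u ^~ g @ \oo --> l.
  move=> g; apply: (cvg_dist_sqr e0) => N M NM.
  by have := ue _ _ [fset g]%fset NM; rewrite big_seq_fset1.
exists l; split=> // N F.
have h : (fun M => \sum_(g <- F) (u M g - u N g) ^+ 2) @ \oo -->
    \sum_(g <- F) (l g - u N g) ^+ 2.
  apply: (@cvg_sum_seq F (fun M g => (u M g - u N g) ^+ 2)
    (fun g => (l g - u N g) ^+ 2)) => g.
  rewrite expr2; under eq_fun do rewrite expr2.
  by apply: cvgM; apply: cvgB; [exact: ul | exact: cvg_cst | exact: ul | exact: cvg_cst].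
apply: cvgr_to_le h _; exists N => // M NM; exact: ue.
Qed.

Definition gr_l2 (a : group_ring G) : G -> R[i] := fun g => ratr a@_g.

Lemma gr_l2E a g : gr_l2 a g = (ratr a@_g : R)%:C%C.
Proof. by rewrite /gr_l2 -(fmorph_rat (real_complex R)). Qed.

Lemma gr_l2_act a : gr_act a (l2_basis R 1%g) = gr_l2 a.
Proof. exact: gr_act_basis. Qed.

Lemma gr_l2P a : l2 (gr_l2 a).
Proof. by rewrite -gr_l2_act; apply: l2_act; exact: l2_basisP. Qed.

Lemma gr_l2_dot a v : l2 v -> l2_dot (gr_l2 a) v = (gr_act (gr_star a) v 1%g)^*.
Proof.
move=> vl; rewrite -gr_l2_act gr_act_star ?l2_dot_basisl //; first exact: l2_act.
exact: l2_basisP.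
Qed.

(** The squared norm of a zeta_e is the trace of a^* a; this turns trace computations in the group
    ring into estimates in l2. *)
Lemma gr_l2_le a : l2_le (gr_l2 a) (ratr (gr_star a * a)@_(1%g)).
Proof.
have [_] := l2_dot_ge0 (gr_l2P a).
have -> : l2_dot (gr_l2 a) (gr_l2 a) = (gr_l2 (gr_star a * a) 1%g)^*.
  by rewrite (gr_l2_dot _ (gr_l2P a)) -!gr_l2_act gr_actM.
rewrite gr_l2E.
by rewrite conj_Creal //; apply/complex_realP; exists (ratr (gr_star a * a)@_(1%g)).
Qed.

Lemma gr_l2B a b : gr_l2 (a - b) = gr_l2 a - gr_l2 b.
Proof. by rewrite -!gr_l2_act gr_actBl. Qed.

End L2Limits.

(** By the bound [e] the vectors W_N zeta_e form a Cauchy sequence; its limit [p0] is the projection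
    of zeta_e on the kernel. It lies in the kernel because [T * W N = 0]. For v in the kernel,
    zeta_e - p0 splits into (1 - W_N - D_N) zeta_e, which is orthogonal to v, and D_N zeta_e + (W_N
    zeta_e - p0), which tends to 0. *)
Lemma vn_dim_ker_limit (R : realType) (G : groupType) (T : group_ring G)
    (W D : nat -> group_ring G) (e d : nat -> R) (rho : R) k :
  (forall N, T * W N = 0) ->
  (forall N (v : G -> R[i]), l2 v -> gr_act T v = 0 ->
    gr_act (gr_star (1 - W N - D N)) v = 0) ->
  (forall N M, (N <= M)%N ->
    ratr (gr_star (W M - W N) * (W M - W N))@_(1%g) <= e N) ->
  (forall N, ratr (gr_star (D N) * D N)@_(1%g) <= d N) ->
  e @ \oo --> (0 : R) -> d @ \oo --> (0 : R) ->
  (fun N => ratr (W N)@_(1%g) : R) @ \oo --> rho ->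
  @vn_dim_ker R G k T%:M = (rho *+ k)%:C%C.
Proof.
move=> TW WD We Dd e0 d0 Wrho.
have lee (f : G -> R[i]) (A B : R) : A <= B -> l2_le f A -> l2_le f B.
  by move=> AB fA F; apply: le_trans (fA F) AB.
have subE (f f' : G -> R[i]) g : (f - f') g = f g - f' g by [].
pose u N g : R := ratr (W N)@_g.
have normc_u N g (x : R) : normc (gr_l2 R (W N) g - x%:C%C) ^+ 2 = (u N g - x) ^+ 2.
  by rewrite gr_l2E -rmorphB /= expr0n addr0 sqrtr_sqr real_normK ?num_real.
have ue N M (F : {fset G}) : (N <= M)%N -> \sum_(g <- F) (u M g - u N g) ^+ 2 <= e N.
  move=> NM; have := lee _ _ _ (We N M NM) (gr_l2_le R (W M - W N)) => /(_ F).
  by under eq_bigr do rewrite gr_l2B subE (gr_l2E _ (W N)) normc_u.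
have [l [ul lu]] := l2_complete e0 ue.
pose p0 g : R[i] := (l g)%:C%C.
have Wp0 N : l2_le (gr_l2 R (W N) - p0) (e N).
  move=> F; apply: le_trans (lu N F); apply: ler_sum => g _.
  by rewrite subE normc_u -sqrrN opprB.
have p0l : l2 p0.
  rewrite -(opprK p0) -(addKr (gr_l2 R (W 0%N)) (- p0)) addrC.
  apply: l2N; apply: l2B; last exact: gr_l2P.
  by apply/l2P; exists (e 0%N).
have Tp0 : gr_act T p0 = 0.
  (* Pointwise convergence suffices: [T] has finite support, so each value of [T p0] is a finite
     combination of values of [p0]. *)
  apply/funext => g; rewrite /gr_act.
  rewrite (_ : \sum_(h <- msupp T) _ =
    (\sum_(h <- msupp T) ratr T@_h * l (h^-1 * g)%g)%:C%C); last first.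
    rewrite rmorph_sum; apply: eq_bigr => h _.
    by rewrite rmorphM fmorph_rat.
  have h1 : (fun N => \sum_(h <- msupp T) ratr T@_h * u N (h^-1 * g)%g) @ \oo -->
      \sum_(h <- msupp T) ratr T@_h * l (h^-1 * g)%g.
    apply: (@cvg_sum_seq R G _ (fun N h => ratr T@_h * u N (h^-1 * g)%g)
      (fun h => ratr T@_h * l (h^-1 * g)%g)) => h.
    by apply: cvgMr; exact: ul.
  suff h2 : (fun N => \sum_(h <- msupp T) ratr T@_h * u N (h^-1 * g)%g) = fun=> 0.
    rewrite h2 in h1; rewrite -(cvg_lim (@Rhausdorff R) h1).
    by rewrite (cvg_lim (@Rhausdorff R) (cvg_cst _)).
  apply/funext => N; apply: complexI; rewrite rmorph0 rmorph_sum.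
  have Tg : gr_act T (gr_l2 R (W N)) g = 0 by rewrite -gr_l2_act -gr_actM TW gr_act0.
  rewrite -[RHS]Tg /gr_act; apply: eq_bigr => h _.
  by rewrite rmorphM fmorph_rat gr_l2E.
rewrite (@vn_dim_ker_scalar R G k T p0) //; last 2 first.
- by rewrite gr_actM Tp0 gr_actr0.
- move=> v vl /(gr_star_kernel vl) Tv.
  have /l2P[B vB] := vl.
  have B0 := l2_le_ge0 vB.
  (* The parameter [s] comes from the AM-GM bound: first N tends to infinity with [s] fixed, then
     [s] is taken large. *)
  have bound N (s : R) : 0 < s ->
      normc (l2_dot (l2_basis R 1%g - p0) v) <= s * (d N + e N) + s^-1 * (2 * B).
    move=> s0.
    have -> : l2_basis R 1%g - p0 =
        gr_l2 R (1 - W N - D N) + (gr_l2 R (D N) + (gr_l2 R (W N) - p0)).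
      have -> : l2_basis R 1%g = gr_l2 R (1 : group_ring G).
        by rewrite -gr_l2_act gr_act1.
      by rewrite !gr_l2B addrA subrK addrA subrK.
    have Dl := gr_l2P R (D N).
    have Wl : l2 (gr_l2 R (W N) - p0) by apply/l2P; exists (e N).
    rewrite (l2_dotDl (gr_l2P R (1 - W N - D N)) (l2D Dl Wl) vl).
    rewrite (gr_l2_dot _ vl) (WD N v vl Tv) rmorph0 add0r (l2_dotDl Dl Wl vl).
    apply: le_trans (le_normcD _ _) _.
    have := l2_dot_le s0 (lee _ _ _ (Dd N) (gr_l2_le R (D N))) vB.
    have := l2_dot_le s0 (Wp0 N) vB.
    by nra.
  have bound' (s : R) : 0 < s ->
      normc (l2_dot (l2_basis R 1%g - p0) v) <= s^-1 * (2 * B).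
    move=> s0.
    have h : (fun N => s * (d N + e N) + s^-1 * (2 * B)) @ \oo -->
        s * (0 + 0) + s^-1 * (2 * B).
      by apply: cvgD; [apply: cvgMr; exact: cvgD | exact: cvg_cst].
    rewrite addr0 mulr0 add0r in h.
    by apply: cvgr_to_ge h _; exists 0%N => // N _; exact: bound.
  apply: ComplexField.Normc.eq0_normc; apply/eqP.
  rewrite eq_le normc_ge0 andbT; apply/ler_addgt0Pr => t t0; rewrite add0r.
  (* With this [s] the bound is t * 2B / (2B + 1), at most t; the added 1 covers B = 0. *)
  have s0 : 0 < (2 * B + 1) / t by rewrite divr_gt0 // ltr_wpDl // mulr_ge0.
  apply: le_trans (bound' _ s0) _; rewrite invf_div -mulrA ler_piMr ?(ltW t0) //.
  by rewrite mulrC ler_pdivrMr ?mul1r ?lerDl // ltr_wpDl // mulr_ge0.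
rewrite -rmorphMn; congr (_ *+ k)%:C%C.
by rewrite -(cvg_lim (@Rhausdorff R) Wrho) (cvg_lim (@Rhausdorff R) (ul 1%g)).
Qed.

Lemma orthogonal_idempotents_sum (Q : nzRingType) (J : eqType) (r : seq J) (e : J -> Q) :
  uniq r -> {in r &, forall i j, e i * e j = if i == j then e i else 0} ->
  (\sum_(i <- r) e i) * (\sum_(i <- r) e i) = \sum_(i <- r) e i.
Proof.
move=> ur ee; rewrite mulr_suml big_seq [RHS]big_seq; apply: eq_bigr => i ir.
rewrite mulr_sumr (bigD1_seq i) //= ee // eqxx big_seq_cond big1 ?addr0 // => j.
by case/andP=> jr /negPf ji; rewrite ee // eq_sym ji.
Qed.

Lemma comm_mulrACA (Q : pzRingType) (x y x' y' : Q) : GRing.comm y x' ->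
  (x * y) * (x' * y') = (x * x') * (y * y').
Proof. by move=> C; rewrite -!mulrA; congr (_ * _); rewrite !mulrA C. Qed.

(** * Chain projections in an abstract ring *)

Section Chains.
Variables (Q : nzRingType) (tz a u w : int -> Q) (c : Q) (m : nat -> Q).
Variable eps : nat -> bool.
Hypothesis tz0 : tz 0 = 1.
Hypothesis tzD : forall k l : int, tz (k + l) = tz k * tz l.
Hypothesis tza : forall k i, tz k * a i = a (i + k) * tz k.
Hypothesis tzw : forall k i, tz k * w i = w (i + k) * tz k.
Hypothesis aa : forall i, a i * a i = a i.
Hypothesis uu : forall i, u i * u i = u i.
Hypothesis ww : forall i, w i * w i = w i.
Hypothesis cc : c * c = c.
Hypothesis aC : forall i j, a i * a j = a j * a i.
Hypothesis auC : forall i j, a i * u j = u j * a i.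
Hypothesis awC : forall i j, a i * w j = w j * a i.
Hypothesis cC : forall x, c * x = x * c.
Hypothesis mC : forall n x, m n * x = x * m n.
Hypothesis mK : forall n, n.+1%:R * m n = 1.
Hypothesis uwC : forall n : nat, eps n -> u 0 * w n%:Z = w n%:Z * u 0.
Hypothesis uwN : forall n : nat, ~~ eps n ->
  c * ((u 0 *+ 2 - 1) * (w n%:Z *+ 2 - 1)) = - (c * ((w n%:Z *+ 2 - 1) * (u 0 *+ 2 - 1))).

Let b (i : int) : Q := 1 - a i.

Definition run (s : int) (n : nat) : Q := \prod_(0 <= i < n) a (s + i%:Z).

(* [chain s n] projects on the configurations with breaks exactly at [s - 1]
   and [s + n] in that range: the positions [s .. s + n] form one chain. *)
Definition chain (s : int) (n : nat) : Q := b (s - 1) * run s n * b (s + n%:Z).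

Lemma run0 s : run s 0 = 1.
Proof. by rewrite /run big_geq. Qed.

Lemma runS s n : run s n.+1 = run s n * a (s + n%:Z).
Proof. by rewrite /run big_nat_recr. Qed.

Lemma bE i : b i * b i = b i.
Proof. by rewrite /b mulrBr mulr1 mulrBl mul1r aa subrr subr0. Qed.

Lemma ab0 i : a i * b i = 0.
Proof. by rewrite /b mulrBr mulr1 aa subrr. Qed.

Lemma comm_run x s n : (forall i, GRing.comm x (a i)) -> GRing.comm x (run s n).
Proof. by move=> xa; apply: commr_prod => i _; exact: xa. Qed.

Lemma comm_b x i : (forall i, GRing.comm x (a i)) -> GRing.comm x (b i).
Proof. by move=> xa; apply: commrB; [exact: commr1 | exact: xa]. Qed.

Lemma comm_chain x s n : (forall i, GRing.comm x (a i)) -> GRing.comm x (chain s n).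
Proof.
move=> xa; apply: commrM; last exact: comm_b.
by apply: commrM; [exact: comm_b | exact: comm_run].
Qed.

Lemma comm_aa i j : GRing.comm (a i) (a j).
Proof. exact: aC. Qed.

Lemma comm_ba i j : GRing.comm (b i) (a j).
Proof. by apply/commr_sym/comm_b => l; exact: comm_aa. Qed.

Lemma comm_chaina s n j : GRing.comm (chain s n) (a j).
Proof. by apply/commr_sym/comm_chain => l; exact: comm_aa. Qed.

Lemma comm_chain_chain s n s' n' : GRing.comm (chain s n) (chain s' n').
Proof. by apply: comm_chain => i; exact: comm_chaina. Qed.

Lemma run_idem s n : run s n * run s n = run s n.
Proof.
elim: n => [|n IHn]; first by rewrite run0 mulr1.
have C : GRing.comm (a (s + n%:Z)) (run s n) by apply: comm_run => i; exact: comm_aa.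
by rewrite runS comm_mulrACA // IHn aa.
Qed.

Lemma a_run (s : int) n (k : int) : s <= k < s + n%:Z -> a k * run s n = run s n.
Proof.
elim: n => [|n IHn]; first by rewrite addr0 ltNge andbC => /andP[/negP].
move=> hk; rewrite runS; have [ksn|ksn] := eqVneq k (s + n%:Z).
  have C : GRing.comm (a k) (run s n) by apply: comm_run => i; exact: comm_aa.
  by rewrite mulrA C -ksn -mulrA aa.
by rewrite mulrA IHn //; lia.
Qed.

Lemma chainC (s : int) n : chain s n = run s n * (b (s - 1) * b (s + n%:Z)).
Proof.
rewrite /chain mulrA; congr (_ * _).
by apply: comm_run => i; exact: comm_ba.
Qed.

Lemma chain_idem (s : int) n : chain s n * chain s n = chain s n.
Proof.
have C1 : GRing.comm (b (s - 1) * b (s + n%:Z)) (run s n).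
  by apply: comm_run => i; apply/commr_sym/commrM; apply/commr_sym; exact: comm_ba.
have C2 : GRing.comm (b (s + n%:Z)) (b (s - 1)) by apply: comm_b => i; exact: comm_ba.
by rewrite !chainC comm_mulrACA // run_idem comm_mulrACA // !bE.
Qed.

Lemma a_chain (s : int) n k : s <= k < s + n%:Z -> a k * chain s n = chain s n.
Proof. by move=> hk; rewrite chainC mulrA a_run. Qed.

Lemma chain_a (s : int) n k : s <= k < s + n%:Z -> chain s n * a k = chain s n.
Proof. by move=> hk; rewrite comm_chaina a_chain. Qed.

Lemma a_chain_start (s : int) n : a (s - 1) * chain s n = 0.
Proof. by rewrite /chain !mulrA ab0 !mul0r. Qed.

Lemma a_chain_end (s : int) n : a (s + n%:Z) * chain s n = 0.
Proof.
rewrite -comm_chaina /chain -(mulrA _ (b _)).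
by rewrite comm_ba ab0 mulr0.
Qed.

Lemma b_chain (s : int) n k : s <= k < s + n%:Z -> b k * chain s n = 0.
Proof. by move=> hk; rewrite /b mulrBl mul1r a_chain // subrr. Qed.

Lemma b_chain_start (s : int) n : b (s - 1) * chain s n = chain s n.
Proof. by rewrite /b mulrBl mul1r a_chain_start subr0. Qed.

Lemma b_chain_end (s : int) n : b (s + n%:Z) * chain s n = chain s n.
Proof. by rewrite /b mulrBl mul1r a_chain_end subr0. Qed.

Lemma chain_b_start (s : int) n : chain s n * b (s - 1) = chain s n.
Proof. by rewrite (comm_b _ (comm_chaina s n)) b_chain_start. Qed.

Lemma chain_b_end (s : int) n : chain s n * b (s + n%:Z) = chain s n.
Proof. by rewrite (comm_b _ (comm_chaina s n)) b_chain_end. Qed.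

(** The bounds say that both chains contain the origin. If they start at different positions, the
    break before the later start falls inside the other chain; if they start together, the end break
    of the shorter one falls inside the longer one. Either way [a k * b k = 0] for some k. *)
Lemma chain_orth i n i' n' : (i <= n)%N -> (i' <= n')%N ->
  chain (- i%:Z) n * chain (- i'%:Z) n' =
  if (i == i') && (n == n') then chain (- i%:Z) n else 0.
Proof.
have key j k j' k' : (j <= k)%N -> (j' <= k')%N ->
    (j' < j)%N || (j == j') && (k < k')%N ->
    chain (- j%:Z) k * chain (- j'%:Z) k' = 0.
  move=> jk jk' /orP[lt|/andP[/eqP <- lt]].
    rewrite -(b_chain_start (- j'%:Z) k') mulrA -(@chain_a _ _ (- j'%:Z - 1)).
      by rewrite -(mulrA (chain _ _)) ab0 mulr0 mul0r.
    lia.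
  rewrite -(@a_chain (- j%:Z) k' (- j%:Z + k%:Z)); last by lia.
  by rewrite mulrA comm_chaina a_chain_end mul0r.
move=> iln iln'; case: ifP => [/andP[/eqP <- /eqP <-]|ne]; first exact: chain_idem.
have [lt|] := boolP ((i' < i)%N || (i == i') && (n < n')%N); first exact: key.
move=> nlt; rewrite comm_chain_chain; apply: key => //.
move: ne nlt; case: (ltngtP i i') => //= _; case: (ltngtP n n') => //.
Qed.

Lemma tz_b k i : tz k * b i = b (i + k) * tz k.
Proof. by rewrite /b mulrBr mulrBl mulr1 mul1r tza. Qed.

Lemma tz_run k s n : tz k * run s n = run (s + k) n * tz k.
Proof.
elim: n => [|n IHn]; first by rewrite !run0 mulr1 mul1r.
by rewrite !runS mulrA IHn -mulrA tza mulrA addrAC.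
Qed.

Lemma tz_chain k s n : tz k * chain s n = chain (s + k) n * tz k.
Proof.
rewrite /chain !mulrA tz_b -[_ * tz k * _]mulrA tz_run mulrA -[_ * tz k * _]mulrA tz_b.
by rewrite !mulrA [s - 1 + k]addrAC [s + n%:Z + k]addrAC.
Qed.

Lemma tzV k : tz k * tz (- k) = 1.
Proof. by rewrite -tzD subrr tz0. Qed.

(** The projection on admissible values at the first position of a chain of n steps. It is a product
    of commuting projections when [eps n] holds; otherwise the anticommuting lamps leave only 0. *)
Definition corner n : Q := if eps n then c * (u 0 * (w n%:Z * chain 0 n)) else 0.

Lemma comm_chain_u s n i : GRing.comm (chain s n) (u i).
Proof. by apply/commr_sym/comm_chain => j; apply/commr_sym; exact: auC. Qed.

Lemma comm_chain_w s n i : GRing.comm (chain s n) (w i).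
Proof. by apply/commr_sym/comm_chain => j; apply/commr_sym; exact: awC. Qed.

Lemma corner_chain n : corner n * chain 0 n = corner n.
Proof.
rewrite /corner; case: eps; rewrite ?mul0r //.
by rewrite -(mulrA c) -(mulrA (u 0)) -(mulrA (w n%:Z)) chain_idem.
Qed.

Lemma comm_corner x n : GRing.comm x (u 0) -> GRing.comm x (w n%:Z) ->
  (forall i, GRing.comm x (a i)) -> GRing.comm x (corner n).
Proof.
move=> xu xw xa; rewrite /corner; case: eps; last exact: commr0.
apply: commrM; first exact/commr_sym/cC.
by apply: commrM => //; apply: commrM => //; exact: comm_chain.
Qed.

Lemma chain_corner n : chain 0 n * corner n = corner n.
Proof.
rewrite -[in RHS]corner_chain; apply: comm_corner => [||i].
- exact: comm_chain_u.
- exact: comm_chain_w.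
- exact: comm_chaina.
Qed.

Lemma c_corner n : c * corner n = corner n.
Proof. by rewrite /corner; case: eps; rewrite ?mulr0 // mulrA cc. Qed.

Lemma u_corner n : u 0 * corner n = corner n.
Proof.
rewrite /corner; case: eps; rewrite ?mulr0 //.
by rewrite mulrA -cC -(mulrA c) (mulrA (u 0)) uu.
Qed.

Lemma w_corner n : w n%:Z * corner n = corner n.
Proof.
rewrite /corner; case e: (eps n); rewrite ?mulr0 //.
by rewrite mulrA -cC -(mulrA c) (mulrA (w _)) -uwC // -(mulrA (u 0)) (mulrA (w _)) ww.
Qed.

Lemma corner_idem n : corner n * corner n = corner n.
Proof.
rewrite {1}/corner; case e: (eps n); last by rewrite mul0r /corner e.
by rewrite -(mulrA c) -(mulrA (u 0)) -(mulrA (w n%:Z)) chain_corner w_corner u_corner c_corner.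
Qed.

(** The elements [tz (- i) * corner n * tz j] with i, j <= n multiply like matrix units of size n +
    1, indexed by the position of the origin in its chain. Their sum is [bwd n * corner n * fwd n],
    and dividing it by n + 1 gives the projection on constant vectors. *)
Definition fwd n : Q := \sum_(0 <= j < n.+1) tz j%:Z.
Definition bwd n : Q := \sum_(0 <= i < n.+1) tz (- i%:Z).

(* The projection on the vectors constant along the chains of length [n], with
   values in the range of [corner n]. *)
Definition chain_proj n : Q := m n * (bwd n * corner n * fwd n).

(** Moving the two translations outwards leaves [chain (- j) n * chain (- i) n'], a product of two
    chains through the origin. *)
Lemma chain_tz_chain n j n' i : (j <= n)%N -> (i <= n')%N ->
  chain 0 n * (tz j%:Z * tz (- i%:Z)) * chain 0 n' =
  if (j == i) && (n == n') then chain 0 n else 0.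
Proof.
move=> jn i_n'.
have e1 : chain 0 n * tz j%:Z = tz j%:Z * chain (- j%:Z) n.
  by rewrite tz_chain addNr.
rewrite mulrA e1 -(mulrA _ (tz (- i%:Z))) (tz_chain (- i%:Z)) add0r mulrA.
rewrite -(mulrA (tz j%:Z)) chain_orth //.
case: ifP => [/andP[/eqP <- _]|_]; last by rewrite mulr0 mul0r.
by rewrite -e1 -(mulrA (chain 0 n)) tzV mulr1.
Qed.

(** Among the products of translates only the n + 1 diagonal ones survive; this is the factor that
    [m n] cancels. *)
Lemma corner_fwd_bwd n n' :
  corner n * (fwd n * bwd n') * corner n' =
  if n == n' then n.+1%:R * corner n else 0.
Proof.
rewrite -{1}corner_chain -{1}[corner n']chain_corner.
rewrite -[X in X * _ = _]mulrA -[LHS]mulrA [X in _ * X]mulrA.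
suff -> : chain 0 n * (fwd n * bwd n') * chain 0 n' =
    if n == n' then n.+1%:R * chain 0 n else 0.
  case: eqP => [<-|_]; last by rewrite mul0r mulr0.
  rewrite -mulrA chain_corner mulrA; have -> : corner n * n.+1%:R = n.+1%:R * corner n.
    exact/commr_nat.
  by rewrite -mulrA corner_idem.
rewrite /fwd /bwd mulr_suml mulr_sumr mulr_suml.
under eq_big_nat => j hj.
  rewrite mulr_sumr mulr_sumr mulr_suml.
  under eq_big_nat => i hi do rewrite chain_tz_chain //.
  over.
case: eqP => [<-|_]; last first.
  by rewrite big1 // => j _; rewrite big1 // => i _; rewrite andbF.
rewrite (eq_big_nat _ _ (F2 := fun=> chain 0 n)).
  by rewrite sumr_const_nat subn0 mulr_natl.
move=> j /andP[_ jn]; rewrite (big_cat_nat (n := j)) //=.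
  rewrite big_nat_cond big1 ?add0r; last first.
    by move=> i /andP[/andP[_ ij] _]; rewrite andbT gtn_eqF.
  rewrite big_ltn // eqxx /= big_nat_cond big1 ?addr0 //.
  by move=> i /andP[/andP[ji _] _]; rewrite andbT ltn_eqF.
exact: ltnW.
Qed.

Lemma chain_proj_orth n n' :
  chain_proj n * chain_proj n' = if n == n' then chain_proj n else 0.
Proof.
rewrite /chain_proj -mulrA [X in _ * X]mulrA -mC -mulrA.
have -> : bwd n * corner n * fwd n * (bwd n' * corner n' * fwd n') =
    bwd n * (corner n * (fwd n * bwd n') * corner n') * fwd n' by rewrite !mulrA.
rewrite corner_fwd_bwd; case: eqP => [<-|_]; last by rewrite mulr0 mul0r !mulr0.
congr (_ * _); rewrite mulrA [bwd n * _]mulrA.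
have -> : bwd n * n.+1%:R = n.+1%:R * bwd n by exact/commr_nat.
by rewrite -(mulrA n.+1%:R) (mulrA (m n)) mC mK mul1r.
Qed.

Lemma mul_proj x n : x * bwd n * corner n = 0 -> x * chain_proj n = 0.
Proof.
by move=> h; rewrite /chain_proj mulrA -mC -(mulrA (m n)) !(mulrA x) h mul0r mulr0.
Qed.

Lemma mul_bwd_corner x n :
  (forall i, (i <= n)%N -> x * tz (- i%:Z) * corner n = 0) ->
  x * bwd n * corner n = 0.
Proof.
move=> h; rewrite /bwd mulr_sumr mulr_suml big_nat_cond big1 // => i.
by rewrite andbT => /andP[_ iln]; exact: h.
Qed.

Lemma comm_c_proj n : (1 - c) * chain_proj n = 0.
Proof.
apply: mul_proj; apply: mul_bwd_corner => i _.
have -> : (1 - c) * tz (- i%:Z) = tz (- i%:Z) * (1 - c).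
  by rewrite mulrBl mulrBr mul1r mulr1 cC.
by rewrite -(mulrA (tz _)) mulrBl mul1r c_corner subrr mulr0.
Qed.

Lemma a_corner_end n : a n%:Z * corner n = 0.
Proof. by rewrite -chain_corner mulrA -(add0r n%:Z) a_chain_end mul0r. Qed.

Lemma a_corner_start n : a (-1) * corner n = 0.
Proof. by rewrite -chain_corner mulrA -(add0r (-1)) a_chain_start mul0r. Qed.

Lemma b_corner n i : (i < n)%N -> b i%:Z * corner n = 0.
Proof. by move=> iln; rewrite -chain_corner mulrA b_chain ?mul0r //; lia. Qed.

Lemma shift_proj n : a 0 * (1 - tz 1) * chain_proj n = 0.
Proof.
apply: mul_proj.
(* The sum telescopes to its two extreme translates. Moved past them, [a 0] becomes [a n] and
   [a (-1)], which vanish on the breaks at the two ends of the chain. *)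
have -> : a 0 * (1 - tz 1) * bwd n = a 0 * (tz (- n%:Z) - tz 1).
  rewrite -mulrA; congr (_ * _).
  rewrite /bwd mulr_sumr (eq_bigr (fun i : nat => tz (1 - i.+1%:Z) - tz (1 - i%:Z))).
    rewrite telescope_sumr // subr0; congr (tz _ - _); lia.
  by move=> i _; rewrite mulrBl mul1r -tzD; congr (tz _ - _); lia.
have e1 : a 0 * tz (- n%:Z) = tz (- n%:Z) * a n%:Z by rewrite tza subrr.
have e2 : a 0 * tz 1 = tz 1 * a (-1) by rewrite tza addNr.
by rewrite mulrBr e1 e2 mulrBl -!(mulrA (tz _)) a_corner_end a_corner_start !mulr0 subrr.
Qed.

(** In the term i = 0 of [bwd n] the origin is the first position and the start lamp condition
    holds. In the others [b (-1)] moves to [b (i - 1)], a break inside the chain, which is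
    impossible. *)
Lemma start_proj n : b (-1) * (1 - u 0) * chain_proj n = 0.
Proof.
apply: mul_proj; apply: mul_bwd_corner => -[_|i iln].
  by rewrite oppr0 tz0 mulr1 -(mulrA (b _)) (mulrBl _ 1 (u 0)) mul1r u_corner subrr mulr0.
have C : GRing.comm (1 - u 0) (b (-1)).
  by apply: comm_b => j; apply/commr_sym/commrB; [exact: commr1 | exact: auC].
have e : b (-1) * tz (- i.+1%:Z) = tz (- i.+1%:Z) * b i%:Z.
  by rewrite tz_b; congr (b _ * _); lia.
rewrite -C -(mulrA (1 - u 0)) e mulrA -(mulrA _ (b _)) b_corner ?mulr0 //.
Qed.

(** Here the exceptional term is i = n, where the origin is the last position; for i < n the break
    at the origin moves to position i, inside the chain. *)
Lemma end_proj n : b 0 * (1 - w 0) * chain_proj n = 0.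
Proof.
apply: mul_proj; apply: mul_bwd_corner => i; rewrite leq_eqVlt => /orP[/eqP->|iln].
  have e : (1 - w 0) * tz (- n%:Z) = tz (- n%:Z) * (1 - w n%:Z).
    by rewrite mulrBl mulrBr mul1r mulr1 tzw subrr.
  rewrite -(mulrA (b 0)) e -(mulrA (b 0)) -(mulrA (tz _)) (mulrBl _ 1 (w n%:Z)).
  by rewrite mul1r w_corner subrr !mulr0.
have C : GRing.comm (1 - w 0) (b 0).
  by apply: comm_b => j; apply/commr_sym/commrB; [exact: commr1 | exact: awC].
have e : b 0 * tz (- i%:Z) = tz (- i%:Z) * b i%:Z by rewrite tz_b subrr.
by rewrite -C -(mulrA (1 - w 0)) e mulrA -(mulrA _ (b _)) b_corner ?mulr0.
Qed.

(** * Reduction modulo the left ideal of elements killing a vector *)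

Section LeftIdeal.
Variables (V : zmodType) (phi : {additive Q -> V}).
Hypothesis phiM : forall x y, phi x = 0 -> phi (y * x) = 0.
Hypothesis phi_c : phi (1 - c) = 0.
Hypothesis phi_shift : phi (a 0 * (1 - tz 1)) = 0.
Hypothesis phi_start : phi (b (-1) * (1 - u 0)) = 0.
Hypothesis phi_end : phi (b 0 * (1 - w 0)) = 0.

(** In the application [phi] sends x to x v for a kernel vector v. Its kernel is a left ideal, so
    equalities may be multiplied on the left only, and each condition on v must be brought to the
    right end of a product. *)
Lemma phi_eq z x y : phi x = phi y -> phi (z * x) = phi (z * y).
Proof.
move=> /eqP; rewrite -subr_eq0 -raddfB => /eqP /(phiM z).
by rewrite mulrBr raddfB => /subr0_eq.
Qed.

(** One step at a time: the chain absorbs a factor [a j] for j < n, and moving it past [tz j]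
    produces the shift defect [a 0 * (1 - tz 1)] on the right. *)
Lemma phi_chain_tz n j : (j <= n)%N -> phi (chain 0 n * tz j%:Z) = phi (chain 0 n).
Proof.
elim: j => [|j IHj] jn; first by rewrite tz0 mulr1.
rewrite -IHj ?(ltnW jn) //; apply/esym/eqP; rewrite -subr_eq0 -raddfB -mulrBr.
have -> : tz j%:Z - tz j.+1%:Z = tz j%:Z * (1 - tz 1).
  by rewrite mulrBr mulr1 -tzD; congr (_ - tz _); lia.
rewrite -(@chain_a 0 n j%:Z); last lia.
have e : a j%:Z * tz j%:Z = tz j%:Z * a 0 by rewrite tza add0r.
by rewrite -(mulrA (chain _ _)) (mulrA (a _)) e -(mulrA (tz _)) mulrA phiM.
Qed.

Lemma phi_chain_u n : phi (u 0 * chain 0 n) = phi (chain 0 n).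
Proof.
apply/esym/eqP; rewrite -subr_eq0 -raddfB -{1}(mul1r (chain _ _)) -mulrBl.
have C : GRing.comm (1 - u 0) (chain 0 n).
  by apply: comm_chain => j; apply/commr_sym/commrB; [exact: commr1 | exact: auC].
by rewrite C -chain_b_start add0r -mulrA phiM.
Qed.

Lemma phi_chain_w n : phi (w n%:Z * chain 0 n) = phi (chain 0 n).
Proof.
apply/esym/eqP; rewrite -subr_eq0 -raddfB -{1}(mul1r (chain _ _)) -mulrBl.
(* The end condition is given at the origin only, so the last position [n] is first carried there by
   inserting [tz n]. *)
rewrite (phi_eq _ (esym (phi_chain_tz (leqnn n)))) mulrA.
have C : GRing.comm (1 - w n%:Z) (chain 0 n).
  by apply: comm_chain => j; apply/commr_sym/commrB; [exact: commr1 | exact: awC].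
have e : (1 - w n%:Z) * tz n%:Z = tz n%:Z * (1 - w 0).
  by rewrite mulrBl mulrBr mul1r mulr1 tzw add0r.
have eb : b n%:Z * tz n%:Z = tz n%:Z * b 0 by rewrite tz_b add0r.
rewrite C -(mulrA (chain _ _)) e -chain_b_end add0r -(mulrA (chain _ _)).
by rewrite (mulrA (b n%:Z)) eb -(mulrA (tz _)) mulrA phiM.
Qed.

Lemma phi_chain_c n : phi (c * chain 0 n) = phi (chain 0 n).
Proof.
apply/esym/eqP; rewrite -subr_eq0 -raddfB -{1}(mul1r (chain _ _)) -mulrBl.
by rewrite mulrBl mul1r cC -{1}(mulr1 (chain _ _)) -mulrBr phiM.
Qed.

(** If [eps n] fails, the lamps X = 2u - 1 and Y = 2w - 1 both fix the chain modulo the left ideal,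
    and so does c. Then the chain is congruent to c X Y chain = - c Y X chain, hence to its own
    opposite, and [m 1], the inverse of 2, removes the factor 2. *)
Lemma phi_chain n : phi (chain 0 n) = phi (corner n).
Proof.
rewrite /corner; case: ifPn => [_|e].
  rewrite (phi_eq c (_ : phi _ = phi (chain 0 n))) ?phi_chain_c //.
  by rewrite (phi_eq (u 0) (phi_chain_w n)) phi_chain_u.
have symP z : phi (z * chain 0 n) = phi (chain 0 n) ->
    phi ((z *+ 2 - 1) * chain 0 n) = phi (chain 0 n).
  move=> h; rewrite mulrBl mul1r raddfB -mulr_natl -mulrA mulr_natl raddfMn h.
  by rewrite mulr2n addrK.
have hu := symP _ (phi_chain_u n); have hw := symP _ (phi_chain_w n).
have h1 : phi (c * ((u 0 *+ 2 - 1) * (w n%:Z *+ 2 - 1)) * chain 0 n) = phi (chain 0 n).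
  rewrite -(mulrA c) -(mulrA (_ - 1)) (phi_eq c (_ : phi _ = phi (chain 0 n))) ?phi_chain_c //.
  by rewrite (phi_eq _ hw).
have h2 : phi (c * ((w n%:Z *+ 2 - 1) * (u 0 *+ 2 - 1)) * chain 0 n) = phi (chain 0 n).
  rewrite -(mulrA c) -(mulrA (_ - 1)) (phi_eq c (_ : phi _ = phi (chain 0 n))) ?phi_chain_c //.
  by rewrite (phi_eq _ hu).
move: h1; rewrite uwN // mulNr raddfN h2 => /eqP; rewrite eq_sym -addr_eq0 -raddfD => /eqP h.
rewrite -[chain 0 n]mul1r -(mK 1) -mC -mulrA; rewrite raddf0; apply: phiM.
by rewrite mulr_natl mulr2n.
Qed.

(** Modulo the left ideal [tz (- i) * corner n * tz j] is congruent to [chain (- i) n] whatever j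
    is; the n + 1 values of j cancel against [m n]. *)
Lemma phi_chain_proj n :
  phi (\sum_(0 <= i < n.+1) chain (- i%:Z) n) = phi (chain_proj n).
Proof.
have h i j : (i <= n)%N -> (j <= n)%N ->
    phi (tz (- i%:Z) * corner n * tz j%:Z) = phi (chain (- i%:Z) n).
  move=> iln jn; rewrite -(mulrA (tz _)) -corner_chain -(mulrA (corner n)).
  rewrite (phi_eq (tz _) (_ : phi _ = phi (chain 0 n))); last first.
    by rewrite (phi_eq _ (phi_chain_tz jn)) corner_chain phi_chain.
  rewrite -(phi_eq (tz (- i%:Z)) (phi_chain_tz iln)) mulrA tz_chain add0r.
  by rewrite -mulrA -tzD addNr tz0 mulr1.
rewrite /chain_proj (phi_eq (m n) (_ : phi _ =
    phi (n.+1%:R * \sum_(0 <= i < n.+1) chain (- i%:Z) n))); last first.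
  rewrite /bwd mulr_suml mulr_suml mulr_sumr !raddf_sum; apply: eq_big_nat => i hi.
  rewrite /fwd mulr_sumr raddf_sum (eq_big_nat _ _ (F2 := fun=> phi (chain (- i%:Z) n))).
    by rewrite sumr_const_nat subn0 mulr_natl raddfMn.
  by move=> j hj; apply: h.
by rewrite mulrA mC mK mul1r.
Qed.

End LeftIdeal.

Definition proj_sum N : Q := \sum_(0 <= n < N) chain_proj n.
(** The first position of a chain through the origin is -i with i <= n. Removing all those with
    fewer than N steps leaves the configurations where the origin has a chain of at least N steps,
    possibly infinite. *)
Definition long_chains N : Q :=
  1 - \sum_(0 <= n < N) \sum_(0 <= i < n.+1) chain (- i%:Z) n.

Lemma phi_proj_sum (V : zmodType) (phi : {additive Q -> V}) N :
  (forall x y, phi x = 0 -> phi (y * x) = 0) ->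
  phi (1 - c) = 0 -> phi (a 0 * (1 - tz 1)) = 0 ->
  phi (b (-1) * (1 - u 0)) = 0 -> phi (b 0 * (1 - w 0)) = 0 ->
  phi (1 - proj_sum N - long_chains N) = 0.
Proof.
move=> h1 h2 h3 h4 h5.
rewrite /long_chains opprB addrC addrA subrK raddfB.
apply/eqP; rewrite subr_eq0; apply/eqP; rewrite /proj_sum !raddf_sum.
by apply: eq_bigr => n _; exact: phi_chain_proj.
Qed.

Lemma proj_sum_diff N M : (N <= M)%N ->
  proj_sum M - proj_sum N = \sum_(N <= n < M) chain_proj n.
Proof.
by move=> NM; rewrite /proj_sum (big_cat_nat (leq0n N) NM) /= addrAC subrr add0r.
Qed.

Lemma proj_sum_diff_idem N M : (N <= M)%N ->
  (proj_sum M - proj_sum N) * (proj_sum M - proj_sum N) = proj_sum M - proj_sum N.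
Proof.
move=> NM; rewrite proj_sum_diff //; apply: orthogonal_idempotents_sum.
  exact: iota_uniq.
by move=> i j _ _; exact: chain_proj_orth.
Qed.

Lemma long_chains_idem N : long_chains N * long_chains N = long_chains N.
Proof.
have idemB (x : Q) : x * x = x -> (1 - x) * (1 - x) = 1 - x.
  by move=> h; rewrite mulrBr mulr1 mulrBl mul1r h subrr subr0.
apply: idemB; apply: orthogonal_idempotents_sum => [|n n' _ _]; first exact: iota_uniq.
case: eqP => [<-|nn'].
  apply: orthogonal_idempotents_sum => [|i i']; first exact: iota_uniq.
  rewrite !mem_index_iota /= => iln i'n.
  by rewrite chain_orth // eqxx andbT.
rewrite mulr_suml big_nat_cond big1 // => i /andP[/andP[_ iln] _].
rewrite mulr_sumr big_nat_cond big1 // => i' /andP[/andP[_ i'n] _].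
by rewrite chain_orth //; case: eqP => //= _; case: eqP.
Qed.

(** * Self-adjointness of the projections *)

Section Involution.
Variable star : Q -> Q.
Hypothesis starD : forall x y, star (x + y) = star x + star y.
Hypothesis starM : forall x y, star (x * y) = star y * star x.
Hypothesis star1 : star 1 = 1.
Hypothesis star_tz : forall k, star (tz k) = tz (- k).
Hypothesis star_a : forall i, star (a i) = a i.
Hypothesis star_u : forall i, star (u i) = u i.
Hypothesis star_w : forall i, star (w i) = w i.
Hypothesis star_c : star c = c.
Hypothesis star_m : forall n, star (m n) = m n.

Lemma star0 : star 0 = 0.
Proof. by apply: (addrI (star 0)); rewrite -starD !addr0. Qed.

Lemma starN x : star (- x) = - star x.
Proof. by apply/eqP; rewrite -addr_eq0 -starD addNr star0. Qed.

Lemma starB x y : star (x - y) = star x - star y.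
Proof. by rewrite starD starN. Qed.

Lemma star_sum (J : Type) (r : seq J) (F : J -> Q) :
  star (\sum_(j <- r) F j) = \sum_(j <- r) star (F j).
Proof. exact: (big_morph star starD star0). Qed.

Lemma star_b i : star (b i) = b i.
Proof. by rewrite /b starB star1 star_a. Qed.

Lemma star_run s n : star (run s n) = run s n.
Proof.
elim: n => [|n IHn]; first by rewrite run0 star1.
by rewrite runS starM IHn star_a; apply: comm_run => i; exact: comm_aa.
Qed.

Lemma star_chain s n : star (chain s n) = chain s n.
Proof.
rewrite {1}/chain !starM !star_b star_run chainC.
have C1 : GRing.comm (b (s + n%:Z)) (run s n) by apply: comm_run => i; exact: comm_ba.
have C2 : GRing.comm (b (s + n%:Z)) (b (s - 1)) by apply: comm_b => i; exact: comm_ba.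
by rewrite mulrA C1 -mulrA C2.
Qed.

Lemma star_corner n : star (corner n) = corner n.
Proof.
rewrite /corner; case e: (eps n); last exact: star0.
rewrite (starM c) (starM (u 0)) (starM (w n%:Z)) star_chain star_u star_w star_c -cC.
congr (_ * _); rewrite comm_chain_w -(mulrA (w _)) comm_chain_u (mulrA (w _)).
by rewrite -uwC // -(mulrA (u 0)).
Qed.

Lemma star_chain_proj n : star (chain_proj n) = chain_proj n.
Proof.
rewrite /chain_proj (starM (m n)) (starM (_ * _)) starM star_m star_corner mC.
congr (_ * _).
have sf : star (fwd n) = bwd n by rewrite star_sum; apply: eq_bigr => j _; exact: star_tz.
have sb : star (bwd n) = fwd n.
  by rewrite star_sum; apply: eq_bigr => j _; rewrite star_tz opprK.
by rewrite sf sb mulrA.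
Qed.

Lemma star_proj_sum N : star (proj_sum N) = proj_sum N.
Proof. by rewrite star_sum; apply: eq_bigr => n _; exact: star_chain_proj. Qed.

Lemma star_long_chains N : star (long_chains N) = long_chains N.
Proof.
rewrite starB star1 star_sum; congr (_ - _); apply: eq_bigr => n _.
by rewrite star_sum; apply: eq_bigr => i _; exact: star_chain.
Qed.

End Involution.

(** * Traces of the projections *)

Section Trace.
Variable tau : {additive Q -> rat}.
Hypothesis tauC : forall x y, tau (x * y) = tau (y * x).

Lemma tau_m n x : tau (m n * x) = n.+1%:R^-1 * tau x.
Proof.
have -> : tau x = n.+1%:R * tau (m n * x).
  by rewrite mulr_natl -raddfMn -mulr_natl mulrA mK mul1r.
by rewrite mulKf // pnatr_eq0.
Qed.

(** A rank-one projection in the matrix units has the trace of one diagonal unit: by cyclicity the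
    trace reduces to that of [corner n * (fwd n * bwd n) * corner n], which is n + 1 times the
    corner. *)
Lemma tau_chain_proj n : tau (chain_proj n) = tau (corner n).
Proof.
rewrite /chain_proj tau_m -(mulrA (bwd n)) tauC -(mulrA (corner n)) -{1}corner_idem.
rewrite -(mulrA (corner n)) tauC corner_fwd_bwd eqxx mulr_natl raddfMn -(mulr_natl (tau _)).
by rewrite mulKf // pnatr_eq0.
Qed.

Lemma tau_proj_sum N M : (N <= M)%N ->
  tau (proj_sum M - proj_sum N) = \sum_(N <= n < M) tau (corner n).
Proof.
move=> NM; rewrite proj_sum_diff // raddf_sum; apply: eq_bigr => n _.
exact: tau_chain_proj.
Qed.

Lemma tau_long_chains N :
  tau (long_chains N) = tau 1 - \sum_(0 <= n < N) n.+1%:R * tau (chain 0 n).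
Proof.
rewrite raddfB raddf_sum; congr (_ - _); apply: eq_bigr => n _.
rewrite raddf_sum (eq_bigr (fun=> tau (chain 0 n))) => [|i _].
  by rewrite sumr_const_nat subn0 mulr_natl.
rewrite -(mulr1 (chain _ _)) -tz0 -(subrr (- i%:Z)) tzD mulrA -{1}(add0r (- i%:Z)).
by rewrite -tz_chain tauC mulrA -tzD addrC opprK addrC subrr tz0 mul1r.
Qed.

End Trace.

End Chains.

(** * Trace, supports and involutions in the group ring *)

Section GroupRingTrace.
Variable G : groupType.
Implicit Types (a b : group_ring G) (g h : G) (x y : rat).

Definition gr_mono g x : group_ring G := mkmalgU g x.

Lemma gr_monoE a : a = \sum_(h <- msupp a) gr_mono h a@_h.
Proof. exact: monalgE. Qed.

Lemma gr_monoM h g x y : gr_mono h x * gr_mono g y = gr_mono (h * g)%g (x * y).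
Proof.
rewrite gr_mulE /gr_mono !msuppU; case: eqP => [->|_].
  by rewrite big_seq_fset0 mul0r monalgU0.
rewrite big_seq_fset1; case: eqP => [->|_]; first by rewrite big_seq_fset0 mulr0 monalgU0.
by rewrite big_seq_fset1 !mcoeffUU.
Qed.

Lemma gr_monoD g x y : gr_mono g (x + y) = gr_mono g x + gr_mono g y.
Proof. exact: monalgUD. Qed.

Lemma gr_mono0 g : gr_mono g 0 = 0.
Proof. exact: monalgU0. Qed.

Lemma gr_mono1 : gr_mono 1%g 1 = 1.
Proof. by []. Qed.

Lemma gr_starEw (d : {fset G}) a : (msupp a `<=` d)%fset ->
  gr_star a = \sum_(h <- d) gr_mono h^-1%g a@_h.
Proof.
move=> ad; rewrite /gr_star (big_fset_incl _ ad) // => h _ /mcoeff_outdom ->.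
exact: monalgU0.
Qed.

Lemma gr_starD a b : gr_star (a + b) = gr_star a + gr_star b.
Proof.
rewrite (gr_starEw (gr_msuppD a b)) (gr_starEw (fsubsetUl _ (msupp b))).
rewrite (gr_starEw (fsubsetUr (msupp a) _)) -big_split /=.
by apply: eq_bigr => h _; rewrite gr_coeffD gr_monoD.
Qed.

Lemma gr_star_mono g x : gr_star (gr_mono g x) = gr_mono g^-1%g x.
Proof. by rewrite (gr_starEw msuppU_le) big_seq_fset1 mcoeffUU. Qed.

Lemma gr_star0 : gr_star (0 : group_ring G) = 0.
Proof. by rewrite /gr_star msupp0 big_seq_fset0. Qed.

Lemma gr_star_sum (J : Type) (r : seq J) (F : J -> group_ring G) :
  gr_star (\sum_(j <- r) F j) = \sum_(j <- r) gr_star (F j).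
Proof. exact: (big_morph _ gr_starD gr_star0). Qed.

Lemma gr_starM a b : gr_star (a * b) = gr_star b * gr_star a.
Proof.
rewrite gr_mulE gr_star_sum /gr_star mulr_sumr; apply: eq_bigr => h _.
rewrite -!/(gr_star _) gr_star_sum mulr_suml; apply: eq_bigr => g _.
by rewrite gr_star_mono gr_monoM invgM mulrC.
Qed.

Definition gr_tr a : rat := a@_(1%g).

Lemma gr_tr_is_zmod_morphism : zmod_morphism gr_tr.
Proof. by move=> a b; exact: mcoeffB. Qed.

HB.instance Definition _ :=
  GRing.isZmodMorphism.Build (group_ring G) rat gr_tr gr_tr_is_zmod_morphism.

Lemma gr_tr_mono g x : gr_tr (gr_mono g x) = x *+ (g == 1%g).
Proof. exact: mcoeffU. Qed.

Lemma gr_trC a b : gr_tr (a * b) = gr_tr (b * a).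
Proof.
rewrite !gr_mulE exchange_big /= !raddf_sum; apply: eq_bigr => g _.
rewrite !raddf_sum; apply: eq_bigr => h _ /=.
rewrite !gr_tr_mono mulrC; congr (_ *+ _).
by rewrite mulg_eq1 -eqg_invLR eq_sym -mulg_eq1.
Qed.

Definition supp_in (H : G -> Prop) a := forall g, a@_g != 0 -> H g.

Section Support.
Variable H : G -> Prop.
Hypothesis HM : forall g h, H g -> H h -> H (g * h)%g.
Hypothesis HV : forall g, H g -> H g^-1%g.

Lemma supp_in_mono g x : H g -> supp_in H (gr_mono g x).
Proof. by move=> Hg h; rewrite mcoeffU; case: (eqVneq g h) => [<-|_]; rewrite ?eqxx. Qed.

Lemma supp_inD a b : supp_in H a -> supp_in H b -> supp_in H (a + b).
Proof.
move=> ha hb g; rewrite gr_coeffD; have [->|/ha//] := eqVneq a@_g 0.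
by rewrite add0r; exact: hb.
Qed.

Lemma supp_inN a : supp_in H a -> supp_in H (- a).
Proof. by move=> ha g; rewrite mcoeffN oppr_eq0; exact: ha. Qed.

Lemma supp_in_sum (J : eqType) (r : seq J) (F : J -> group_ring G) :
  {in r, forall j, supp_in H (F j)} -> supp_in H (\sum_(j <- r) F j).
Proof.
move=> hF; rewrite big_seq; elim/big_ind: _ => [g||] //.
  by rewrite mcoeff0 eqxx.
exact: supp_inD.
Qed.

Lemma supp_inM a b : supp_in H a -> supp_in H b -> supp_in H (a * b).
Proof.
move=> ha hb; rewrite gr_mulE; apply: supp_in_sum => h hh.
apply: supp_in_sum => g gg; apply: supp_in_mono; apply: HM.
  by apply: ha; rewrite mcoeff_neq0.
by apply: hb; rewrite mcoeff_neq0.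
Qed.

Lemma gr_tr_mulr_mono a g x : supp_in H a -> ~ H g -> gr_tr (a * gr_mono g x) = 0.
Proof.
move=> ha ng; rewrite (gr_monoE a) mulr_suml raddf_sum big_seq big1 // => h hh.
rewrite /= gr_monoM gr_tr_mono; case: eqP => //= hg.
have e : g = h^-1%g by apply/esym; apply: mulg1_eq.
case: ng; rewrite e; apply: HV; apply: ha; by rewrite mcoeff_neq0.
Qed.

End Support.

(** For an involution g this is its spectral projection for the eigenvalue 1. *)
Definition half_sum g : group_ring G := gr_mono 1%g (1 / 2) + gr_mono g (1 / 2).

Lemma half_sum_idem g : (g * g = 1)%g -> half_sum g * half_sum g = half_sum g.
Proof.
move=> gg; rewrite /half_sum mulrDl !mulrDr !gr_monoM gg !mul1g !mulg1.
rewrite [X in _ + X]addrC addrACA -!gr_monoD.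
by congr (gr_mono _ _ + gr_mono _ _).
Qed.

Lemma half_sum_star g : (g * g = 1)%g -> gr_star (half_sum g) = half_sum g.
Proof.
move=> gg; rewrite gr_starD !gr_star_mono invg1.
by have -> : g^-1%g = g by apply: mulg1_eq.
Qed.

Lemma half_sum_comm g h : (g * h = h * g)%g ->
  half_sum g * half_sum h = half_sum h * half_sum g.
Proof.
move=> gh; rewrite /half_sum !mulrDl !mulrDr !gr_monoM !mul1g !mulg1 gh.
by rewrite addrACA.
Qed.

Lemma half_sum_conj k g h : (k * g = h * k)%g ->
  gr_mono k 1 * half_sum g = half_sum h * gr_mono k 1.
Proof.
by move=> kg; rewrite /half_sum mulrDl mulrDr !gr_monoM mul1g mulg1 kg mulr1 mul1r.
Qed.

Lemma half_sum_mul2 g : half_sum g *+ 2 - 1 = gr_mono g 1.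
Proof.
rewrite mulr2n /half_sum addrACA -!gr_monoD.
by rewrite (_ : 1 / 2 + 1 / 2 = 1 :> rat) // gr_mono1 addrAC subrr add0r.
Qed.

Lemma gr_mono_comm g x : (forall h, (g * h = h * g)%g) ->
  forall a, gr_mono g x * a = a * gr_mono g x.
Proof.
move=> gC a; rewrite {1}(gr_monoE a) mulr_sumr [in RHS](gr_monoE a) mulr_suml.
by apply: eq_bigr => h _; rewrite !gr_monoM gC mulrC.
Qed.

Lemma half_sum_central g : (forall h, (g * h = h * g)%g) ->
  forall a, half_sum g * a = a * half_sum g.
Proof.
move=> gC a; apply/commr_sym/commrD; apply/commr_sym/gr_mono_comm => // h.
by rewrite mul1g mulg1.
Qed.

Lemma supp_in_half_sum (H : G -> Prop) g : H 1%g -> H g -> supp_in H (half_sum g).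
Proof. by move=> H1 Hg; apply: supp_inD; exact: supp_in_mono. Qed.

(** An independence statement: if [a] is supported in [H] and g is outside, no product h g with h in
    the support is 1, so only the half of the identity contributes. *)
Lemma gr_tr_mul_half_sum (H : G -> Prop) a g :
  (forall g, H g -> H g^-1%g) -> supp_in H a -> ~ H g ->
  gr_tr (a * half_sum g) = gr_tr a / 2.
Proof.
move=> HV ha ng; rewrite mulrDr raddfD /= (gr_tr_mulr_mono HV _ ha ng) addr0.
rewrite (gr_monoE a) mulr_suml !raddf_sum mulr_suml; apply: eq_bigr => h _ /=.
by rewrite gr_monoM mulg1 !gr_tr_mono mul1r mulrnAl.
Qed.

Definition gr_inv n : group_ring G := gr_mono 1%g n.+1%:R^-1.

Lemma gr_invC n a : gr_inv n * a = a * gr_inv n.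
Proof. by apply: gr_mono_comm => h; rewrite mul1g mulg1. Qed.

Lemma gr_mono_natr n : (n%:R : group_ring G) = gr_mono 1%g n%:R.
Proof.
elim: n => [|n IHn]; first by rewrite gr_mono0.
by rewrite -!natr1 gr_monoD IHn.
Qed.

Lemma gr_invK n : n.+1%:R * gr_inv n = 1.
Proof.
by rewrite gr_mono_natr gr_monoM mul1g divff ?pnatr_eq0.
Qed.

Lemma gr_star_inv n : gr_star (gr_inv n) = gr_inv n.
Proof. by rewrite gr_star_mono invg1. Qed.

End GroupRingTrace.

(** * The twisted lamplighter groups *)

Section LinearExtension.
Variables (A : comNzRingType) (K : choiceType) (V : lmodType A) (phi : K -> V).
Implicit Types (f g : {malg A[K]}).

Definition lin_ext f : V := \sum_(k <- msupp f) f@_k *: phi k.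

Lemma lin_extEw (d : {fset K}) f : (msupp f `<=` d)%fset ->
  lin_ext f = \sum_(k <- d) f@_k *: phi k.
Proof.
move=> fd; rewrite /lin_ext (big_fset_incl _ fd) // => k _ /mcoeff_outdom ->.
exact: scale0r.
Qed.

Lemma lin_extD f g : lin_ext (f + g) = lin_ext f + lin_ext g.
Proof.
rewrite (lin_extEw (msuppD_le f g)) (lin_extEw (fsubsetUl _ (msupp g))).
rewrite (lin_extEw (fsubsetUr (msupp f) _)) -big_split /=.
by apply: eq_bigr => k _; rewrite mcoeffD scalerDl.
Qed.

Lemma lin_ext0 : lin_ext 0 = 0.
Proof. by rewrite /lin_ext msupp0 big_seq_fset0. Qed.

Lemma lin_extN f : lin_ext (- f) = - lin_ext f.
Proof. by apply/eqP; rewrite -addr_eq0 -lin_extD addNr lin_ext0. Qed.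

Lemma lin_extU k (x : A) : lin_ext (mkmalgU k x) = x *: phi k.
Proof. by rewrite (lin_extEw msuppU_le) big_seq_fset1 mcoeffUU. Qed.

End LinearExtension.

Lemma malg_ext (A : zmodType) (K : choiceType) (V : zmodType)
    (F F' : {malg A[K]} -> V) :
  (forall f g, F (f + g) = F f + F g) -> (forall f g, F' (f + g) = F' f + F' g) ->
  (forall k x, F (mkmalgU k x) = F' (mkmalgU k x)) -> F =1 F'.
Proof.
move=> FD F'D FU.
have z0 (E : {malg A[K]} -> V) : (forall f g, E (f + g) = E f + E g) -> E 0 = 0.
  by move=> ED; apply: (addrI (E 0)); rewrite -ED !addr0.
move=> f; rewrite (monalgE f) (big_morph F FD (z0 _ FD)) (big_morph F' F'D (z0 _ F'D)).
by apply: eq_bigr => k _; exact: FU.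
Qed.

(* A site is a position together with the kind of one of its three lamps: [None]
   for the break lamp, [Some false] for the start lamp, [Some true] for the end
   lamp. *)
Definition site : choiceType := (int * option bool)%type.

Section TwistedLamplighter.
Variables (A : comNzRingType) (eps : nat -> bool).
Local Notation lamps := {malg A[site]}.

Definition move_site (n : int) (k : site) : site := (k.1 + n, k.2).

Definition shift (n : int) : lamps -> lamps :=
  lin_ext (fun k => mkmalgU (move_site n k) 1).

(* The start lamp at [i] and the end lamp at [i + n] commute iff [eps n]. *)
Definition twist (k l : site) : A^o :=
  match k, l with
  | (i, Some false), (j, Some true) =>
      if j - i is Posz n then (~~ eps n)%:R else 0
  | _, _ => 0
  end.

Lemma twist_start_end (n : nat) :
  twist ((0, Some false) : site) ((n%:Z, Some true) : site) = (~~ eps n)%:R.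
Proof. by rewrite /twist; have -> : n%:Z - 0 = n%:Z by rewrite subr0. Qed.

(** The bilinear extension of [twist]. It is deliberately not symmetric: the commutator of two lamp
    configurations is the difference of its two orders. *)
Definition cocycle (f g : lamps) : A :=
  lin_ext (fun k => lin_ext (twist k) g : A^o) f.

Lemma shiftD n f g : shift n (f + g) = shift n f + shift n g.
Proof. exact: lin_extD. Qed.

Lemma shift_site n k x : shift n (mkmalgU k x) = mkmalgU (move_site n k) x.
Proof.
rewrite /shift lin_extU; apply/malgP => l.
by rewrite mcoeffZ !mcoeffU mulrnAr mulr1.
Qed.

Lemma shift_shift n m f : shift n (shift m f) = shift (n + m) f.
Proof.
move: f; apply: malg_ext => [f g|f g|k x]; rewrite ?shiftD // !shift_site.
by congr mkmalgU; rewrite /move_site /= -addrA (addrC m).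
Qed.

Lemma shift0 f : shift 0 f = f.
Proof.
move: f; apply: malg_ext => [f g|f g|[i s] x]; rewrite ?shiftD // shift_site.
by rewrite /move_site /= addr0.
Qed.

Lemma shiftN n f : shift n (- f) = - shift n f.
Proof. exact: lin_extN. Qed.

Lemma shift_zero n : shift n 0 = 0.
Proof. exact: lin_ext0. Qed.

Lemma cocycleDl f f' g : cocycle (f + f') g = cocycle f g + cocycle f' g.
Proof. by rewrite /cocycle lin_extD. Qed.

Lemma cocycle0l g : cocycle 0 g = 0.
Proof. by rewrite /cocycle lin_ext0. Qed.

Lemma cocycleDr f g g' : cocycle f (g + g') = cocycle f g + cocycle f g'.
Proof.
rewrite /cocycle /lin_ext -big_split; apply: eq_bigr => k _ /=.
by rewrite -!/(lin_ext _ _) lin_extD scalerDr.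
Qed.

Lemma cocycle0r f : cocycle f 0 = 0.
Proof. by apply: (addrI (cocycle f 0)); rewrite -cocycleDr !addr0. Qed.

Lemma cocycleNr f g : cocycle f (- g) = - cocycle f g.
Proof. by apply/eqP; rewrite -addr_eq0 -cocycleDr addNr cocycle0r. Qed.

Lemma cocycleNl f g : cocycle (- f) g = - cocycle f g.
Proof. by apply/eqP; rewrite -addr_eq0 -cocycleDl addNr cocycle0l. Qed.

Lemma cocycle_site k l x y :
  cocycle (mkmalgU k x) (mkmalgU l y) = x * (y * twist k l).
Proof. by rewrite /cocycle !lin_extU. Qed.

Lemma twist_move n k l : twist (move_site n k) (move_site n l) = twist k l.
Proof.
case: k l => i [[]|] [j [[]|]] //=.
by rewrite opprD addrACA subrr addr0.
Qed.

Lemma cocycle_shift n f g : cocycle (shift n f) (shift n g) = cocycle f g.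
Proof.
move: f; apply: malg_ext => [f f'|f f'|k x]; rewrite ?shiftD ?cocycleDl //.
move: g; apply: malg_ext => [g g'|g g'|l y]; rewrite ?shiftD ?cocycleDr //.
by rewrite !shift_site !cocycle_site twist_move.
Qed.

(** The carrier does not depend on [eps], but the product does; the phantom argument keeps the group
    structures for different [eps] apart. *)
Definition tlamp_type (_ : nat -> bool) : Type := (lamps * A * int)%type.
Local Notation tlamp := (tlamp_type eps).
HB.instance Definition _ := Choice.on tlamp.

(** The central extension of the lamp configurations by [A] along [cocycle], in semidirect product
    with the integers acting by shifts. Bilinearity and shift invariance of the cocycle give
    associativity. *)
Definition tl_mul (p q : tlamp) : tlamp :=
  (p.1.1 + shift p.2 q.1.1, p.1.2 + q.1.2 + cocycle p.1.1 (shift p.2 q.1.1), p.2 + q.2).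
Definition tl_one : tlamp := (0, 0, 0).
Definition tl_inv (p : tlamp) : tlamp :=
  (- shift (- p.2) p.1.1, - p.1.2 + cocycle p.1.1 p.1.1, - p.2).

Lemma tl_mulA : associative tl_mul.
Proof.
move=> [[f d] n] [[g e] m] [[h c] l]; rewrite /tl_mul /=.
rewrite shiftD shift_shift cocycleDr cocycleDl -(cocycle_shift n g) shift_shift !addrA.
do 2!congr pair; set x := cocycle _ _; set y := cocycle _ _; set z := cocycle _ _.
ring.
Qed.

Lemma tl_mul1 : left_id tl_one tl_mul.
Proof.
by move=> [[f d] n]; rewrite /tl_mul /= shift0 cocycle0l !add0r addr0.
Qed.

Lemma tl_mulr1 : right_id tl_one tl_mul.
Proof.
by move=> [[f d] n]; rewrite /tl_mul /= shift_zero cocycle0r !addr0.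
Qed.

Lemma tl_mulV : left_inverse tl_one tl_inv tl_mul.
Proof.
move=> [[f d] n]; rewrite /tl_mul /= !addNr cocycleNl cocycle_shift.
by rewrite addrAC addrK addNr.
Qed.

Lemma tl_mulrV : right_inverse tl_one tl_inv tl_mul.
Proof.
move=> [[f d] n]; rewrite /tl_mul /= shiftN shift_shift subrr shift0.
by rewrite subrr cocycleNr addrA subrr add0r subrr.
Qed.

HB.instance Definition _ := isGroup.Build tlamp
  tl_mulA tl_mul1 tl_mulr1 tl_mulV tl_mulrV.


Hypothesis A2 : 1 + 1 = 0 :> A.

Definition lamp (k : site) : tlamp := (mkmalgU k 1, 0, 0).
Definition translation (n : int) : tlamp := (0, 0, n).
Definition central_elt : tlamp := (0, 1, 0).

Lemma tl_mulE (p q : tlamp) : (p * q)%g = tl_mul p q.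
Proof. by []. Qed.

Lemma lampM k l :
  (lamp k * lamp l)%g = (mkmalgU k 1 + mkmalgU l 1, twist k l : A, 0) :> tlamp.
Proof.
rewrite tl_mulE /tl_mul /= shift0 cocycle_site !mul1r !add0r //.
Qed.

Lemma lampK k : twist k k = 0 -> (lamp k * lamp k = 1)%g.
Proof.
by move=> kk; rewrite lampM kk -monalgUD A2 monalgU0.
Qed.

Lemma lamp_comm k l : twist k l = twist l k -> (lamp k * lamp l = lamp l * lamp k)%g.
Proof. by move=> kl; rewrite !lampM kl addrC. Qed.

Lemma lamp_anticomm k l : twist k l = 1 -> twist l k = 0 ->
  (lamp k * lamp l = central_elt * (lamp l * lamp k))%g.
Proof.
move=> kl lk; rewrite !lampM kl lk tl_mulE /tl_mul /= shift0 cocycle0l.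
by rewrite add0r !addr0 addrC.
Qed.

Lemma translationD n m : translation (n + m) = (translation n * translation m)%g.
Proof. by rewrite tl_mulE /tl_mul /= shift_zero cocycle0l !addr0. Qed.

Lemma translation0 : translation 0 = 1%g.
Proof. by []. Qed.

Lemma translation_lamp n k :
  (translation n * lamp k = lamp (move_site n k) * translation n)%g.
Proof.
rewrite !tl_mulE /tl_mul /= shift_site shift_zero cocycle0l cocycle0r.
by rewrite !add0r !addr0.
Qed.

Lemma central_eltK : (central_elt * central_elt = 1)%g.
Proof. by rewrite tl_mulE /tl_mul /= shift_zero cocycle0l !addr0 A2. Qed.

Lemma central_eltC p : (central_elt * p = p * central_elt)%g.
Proof.
case: p => [[f d] n]; rewrite !tl_mulE /tl_mul /= shift0 shift_zero cocycle0l cocycle0r.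
by rewrite !add0r !addr0 [d + 1]addrC.
Qed.

Lemma central_elt_neq1 : central_elt <> 1%g.
Proof. by case=> /eqP; rewrite oner_eq0. Qed.

(** The subgroup generated, for [A] = F_2, by the central element and all lamps except [k]; it
    serves as the support subgroup in the independence argument. *)
Definition unlit (k : site) (p : tlamp) : Prop := p.2 = 0 /\ p.1.1@_k = 0.

Lemma unlitM k p q : unlit k p -> unlit k q -> unlit k (p * q)%g.
Proof.
case: p q => [[f d] n] [[g e] m] [/= n0 fk] [/= m0 gk]; split=> /=.
  by rewrite n0 m0.
by rewrite mcoeffD n0 shift0 fk gk addr0.
Qed.

Lemma unlitV k p : unlit k p -> unlit k p^-1%g.
Proof.
case: p => [[f d] n] [/= n0 fk]; split=> /=; first by rewrite n0 oppr0.
by rewrite n0 oppr0 shift0 mcoeffN fk oppr0.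
Qed.

Lemma unlit1 k : unlit k 1%g.
Proof. by split=> //=; exact: mcoeff0. Qed.

Lemma unlit_central k : unlit k central_elt.
Proof. by split=> //=; exact: mcoeff0. Qed.

Lemma unlit_lamp k l : l != k -> unlit k (lamp l).
Proof. by move=> /negPf lk; split=> //=; rewrite mcoeffU lk. Qed.

Lemma lit_lamp k : ~ unlit k (lamp k).
Proof. by case=> _ /= /eqP; rewrite mcoeffUU oner_eq0. Qed.

Hypothesis A01 : forall x : A, x = 0 \/ x = 1.

Lemma tlamp_finitely_generated : finitely_generated tlamp.
Proof.
exists [:: translation 1; central_elt; lamp (0, None); lamp (0, Some false); lamp (0, Some true)].
move=> H [H1 HD] sH.
have HV p : p \in H -> p^-1%g \in H by move=> pH; rewrite -div1g; exact: HD.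
have HM p q : p \in H -> q \in H -> (p * q)%g \in H.
  by move=> pH qH; rewrite -[q]invgK; apply: HD => //; exact: HV.
have := introT allP sH => /= /and5P[Ht1 Hz Hy Hx /andP[Hw _]].
have Ht n : translation n \in H.
  have Hn (j : nat) : translation j%:Z \in H.
    elim: j => [|j IHj]; first by rewrite translation0.
    by rewrite -addn1 PoszD translationD HM.
  case: n => j //; rewrite NegzE.
  have -> : translation (- j.+1%:Z) = (translation j.+1%:Z)^-1%g.
    by apply/esym/mulg1_eq; rewrite -translationD subrr.
  exact: HV.
have Hl k : lamp k \in H.
  have -> : lamp k = (translation k.1 * lamp (0%R, k.2) * (translation k.1)^-1)%g.
    by rewrite translation_lamp mulgK /move_site /= add0r; case: k.
  by apply: HD => //; apply: HM => //; case: (k.2) => [[]|].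
have Hc (d : A) : ((0, d, 0) : tlamp) \in H.
  by case: (A01 d) => ->.
(* The central coordinate [d] is kept arbitrary in the induction so that it can absorb the cocycle
   term of each product. *)
have Hf f : forall d : A, ((f, d, 0) : tlamp) \in H.
  rewrite (monalgE f); elim/big_ind: _ => [|f1 f2 h1 h2 d|k _ d]; first exact: Hc.
    have -> : ((f1 + f2, d, 0) : tlamp) =
        (((f1, 0, 0) : tlamp) * ((f2, d - cocycle f1 f2, 0) : tlamp))%g.
      by rewrite tl_mulE /tl_mul /= shift0 add0r subrK addr0.
    exact: HM.
  case: (A01 f@_k) => ->; first by rewrite monalgU0.
  have -> : ((mkmalgU k 1, d, 0) : tlamp) = (((0, d, 0) : tlamp) * lamp k)%g.
    by rewrite tl_mulE /tl_mul /= shift0 cocycle0l !add0r !addr0.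
  by apply: HM.
move=> [[f d] n].
have -> : ((f, d, n) : tlamp) = (((f, d, 0) : tlamp) * translation n)%g.
  by rewrite tl_mulE /tl_mul /= shift0 cocycle0r !addr0 add0r.
by apply: HM.
Qed.

End TwistedLamplighter.

(** * The operator, its kernel and its traces *)

Section LampElements.
Variables (G : groupType) (eps : nat -> bool).
Variables (lamp : int -> option bool -> G) (tr : int -> G) (z : G).
Variable unlit : int -> option bool -> G -> Prop.
Hypothesis tr0 : tr 0 = 1%g.
Hypothesis trD : forall n m : int, tr (n + m) = (tr n * tr m)%g.
Hypothesis tr_lamp : forall (n i : int) s, (tr n * lamp i s = lamp (i + n)%R s * tr n)%g.
Hypothesis lamp_sqr : forall i s, (lamp i s * lamp i s = 1)%g.
Hypothesis lamp_comm_none : forall i j s, (lamp i None * lamp j s = lamp j s * lamp i None)%g.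
Hypothesis z_sqr : (z * z = 1)%g.
Hypothesis z_central : forall g, (z * g = g * z)%g.
Hypothesis z_neq1 : z <> 1%g.
Hypothesis lamp_start_end : forall n : nat, eps n ->
  (lamp 0%R (Some false) * lamp n%:Z (Some true) =
   lamp n%:Z (Some true) * lamp 0%R (Some false))%g.
Hypothesis lamp_start_endN : forall n : nat, ~~ eps n ->
  (lamp 0%R (Some false) * lamp n%:Z (Some true) =
   z * (lamp n%:Z (Some true) * lamp 0%R (Some false)))%g.
Hypothesis unlitM : forall i s g h, unlit i s g -> unlit i s h -> unlit i s (g * h)%g.
Hypothesis unlitV : forall i s g, unlit i s g -> unlit i s g^-1%g.
Hypothesis unlit1 : forall i s, unlit i s 1%g.
Hypothesis unlit_z : forall i s, unlit i s z.
Hypothesis unlit_lamp : forall i s j s', (j, s') != (i, s) -> unlit i s (lamp j s').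
Hypothesis lit_lamp : forall i s, ~ unlit i s (lamp i s).

Local Notation Q := (group_ring G).

Let tz (n : int) : Q := gr_mono (tr n) 1.
Let a (i : int) : Q := half_sum (lamp i None).
Let u (i : int) : Q := half_sum (lamp i (Some false)).
Let w (i : int) : Q := half_sum (lamp i (Some true)).
Let c : Q := 1 - half_sum z.
Let m (n : nat) : Q := gr_inv G n.

Lemma tz_zero : tz 0 = 1.
Proof. by rewrite /tz tr0. Qed.

Lemma tz_add (k l : int) : tz (k + l) = tz k * tz l.
Proof. by rewrite /tz gr_monoM mulr1 trD. Qed.

Lemma tz_half_sum s (k i : int) :
  tz k * half_sum (lamp i s) = half_sum (lamp (i + k) s) * tz k.
Proof. by apply: half_sum_conj; exact: tr_lamp. Qed.

Lemma half_sum_lamp_idem s i : half_sum (lamp i s) * half_sum (lamp i s) = half_sum (lamp i s).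
Proof. by apply: half_sum_idem; exact: lamp_sqr. Qed.

Lemma break_comm s (i j : int) : a i * half_sum (lamp j s) = half_sum (lamp j s) * a i.
Proof. by apply: half_sum_comm; exact: lamp_comm_none. Qed.

Lemma c_idem : c * c = c.
Proof.
have h : half_sum (z) * half_sum (z)
    = half_sum (z) by apply: half_sum_idem; exact: z_sqr.
by rewrite /c mulrBr mulr1 mulrBl mul1r h subrr subr0.
Qed.

Lemma c_central x : c * x = x * c.
Proof.
apply/commr_sym/commrB; first exact: commr1.
by apply/esym/half_sum_central => h; exact: z_central.
Qed.

Lemma u_w_comm (n : nat) : eps n -> u 0 * w n%:Z = w n%:Z * u 0.
Proof.
by move=> en; apply: half_sum_comm; exact: lamp_start_end.
Qed.

(** Doubling a projection and subtracting 1 recovers its lamp, and [c] projects on z = -1, so the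
    commutator z becomes a sign. *)
Lemma u_w_anticomm (n : nat) : ~~ eps n ->
  c * ((u 0 *+ 2 - 1) * (w n%:Z *+ 2 - 1)) = - (c * ((w n%:Z *+ 2 - 1) * (u 0 *+ 2 - 1))).
Proof.
move=> en; pose x := lamp 0 (Some false); pose y := lamp n%:Z (Some true).
have -> : u 0 *+ 2 - 1 = gr_mono x 1 by exact: half_sum_mul2.
have -> : w n%:Z *+ 2 - 1 = gr_mono y 1 by exact: half_sum_mul2.
have -> : gr_mono x 1 * gr_mono y 1 =
    gr_mono (z) 1 * (gr_mono y 1 * gr_mono x 1).
  rewrite !gr_monoM !mulr1; congr gr_mono; exact: lamp_start_endN.
rewrite mulrA.
have -> : c * gr_mono (z) 1 = - c; last by rewrite mulNr.
rewrite -half_sum_mul2.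
have h : half_sum (z) * half_sum (z)
    = half_sum (z) by apply: half_sum_idem; exact: z_sqr.
rewrite /c; move: (half_sum z) h => e h.
by rewrite mulrBr mulr1 mulrnAr mulrBl mul1r h subrr mul0rn sub0r.
Qed.

Lemma star_half_sum_lamp s i : gr_star (half_sum (lamp i s)) = half_sum (lamp i s).
Proof. by apply: half_sum_star; exact: lamp_sqr. Qed.

Lemma gr_star1 : gr_star (1 : Q) = 1.
Proof. by rewrite -gr_mono1 gr_star_mono invg1. Qed.

Lemma star_central_proj : gr_star c = c.
Proof.
rewrite /c; have starN (x : Q) : gr_star (- x) = - gr_star x.
  by apply/eqP; rewrite -addr_eq0 -gr_starD addNr gr_star0.
rewrite gr_starD starN gr_star1 half_sum_star //; exact: z_sqr.
Qed.

Lemma star_translation k : gr_star (tz k) = tz (- k).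
Proof.
rewrite gr_star_mono; congr gr_mono; apply: mulg1_eq.
by rewrite -trD subrr.
Qed.

Local Notation chain := (chain a).
Local Notation corner := (corner a u w c eps).

Lemma tr_half_sum (x : Q) (i : int) s : supp_in (unlit i s) x ->
  gr_tr (x * half_sum (lamp i s)) = gr_tr x / 2.
Proof.
move=> hx; apply: (gr_tr_mul_half_sum _ hx); last exact: lit_lamp.
by move=> g; exact: unlitV.
Qed.

Lemma supp_in_half_lamp (i j : int) s s' : (j, s') != (i, s) ->
  supp_in (unlit i s) (half_sum (lamp j s')).
Proof. by move=> ne; apply: supp_in_half_sum; [exact: unlit1 | exact: unlit_lamp]. Qed.

Lemma supp_in_mulr (i : int) s (x y : Q) :
  supp_in (unlit i s) x -> supp_in (unlit i s) y -> supp_in (unlit i s) (x * y).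
Proof. by apply: supp_inM => g h; exact: unlitM. Qed.

Lemma supp_in_one (i : int) s : supp_in (unlit i s) (1 : Q).
Proof. by apply: supp_in_mono; exact: unlit1. Qed.

Lemma tr_mul_chain (x : Q) n :
  (forall j : int, supp_in (unlit j None) x) ->
  gr_tr (x * chain 0 n) = gr_tr x / 2 ^+ (n + 2).
Proof.
move=> hx; have bE (i : int) (y : Q) : supp_in (unlit i None) y ->
    gr_tr (y * (1 - a i)) = gr_tr y / 2.
  by move=> hy; rewrite mulrBr mulr1 raddfB /= (tr_half_sum hy); field.
have ha (i j : int) : j != i -> supp_in (unlit i None) (a j).
  by move=> ji; apply: supp_in_half_lamp; rewrite xpair_eqE (negPf ji).
have hb (i j : int) : j != i -> supp_in (unlit i None) (1 - a j).
  by move=> ji; apply: supp_inD; [exact: supp_in_one | apply: supp_inN; exact: ha].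
(* [y j] does not involve the break lamp at [j], so each further factor, and the final break at [n],
   halves the trace. *)
pose y j := x * (1 - a (0 - 1)) * run a 0 j.
have hy (j i : nat) : (i <= j)%N -> supp_in (unlit j%:Z None) (y i).
  elim: i => [|i IHi] ij.
    by rewrite /y run0 mulr1; apply: supp_in_mulr => //; exact: hb.
  rewrite /y runS mulrA; apply: supp_in_mulr; first by apply: IHi; exact: ltnW.
  by apply: ha; rewrite add0r eqz_nat neq_ltn ij.
have ty (j : nat) : gr_tr (y j) = gr_tr x / 2 ^+ j.+1.
  elim: j => [|j IHj]; first by rewrite /y run0 mulr1 bE // expr1.
  rewrite /y runS mulrA add0r (tr_half_sum (hy j j (leqnn j))) -/(y j) IHj.
  by rewrite [in RHS]exprS; field; rewrite expf_neq0.
rewrite /chain !mulrA add0r bE; last by apply: (hy n n).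
rewrite -/(y n) ty addn2 [in RHS]exprS; field; by rewrite expf_neq0.
Qed.

Lemma tr_chain n : gr_tr (chain 0 n) = 1 / 2 ^+ (n + 2).
Proof.
rewrite -[chain 0 n]mul1r tr_mul_chain; last by move=> j; exact: supp_in_one.
by rewrite -gr_mono1 gr_tr_mono eqxx.
Qed.

Lemma tr_corner n : gr_tr (corner n) = (eps n)%:R / 2 ^+ (n + 5).
Proof.
rewrite /corner; case: ifPn => en; last by rewrite raddf0 mul0r.
have hc i s : supp_in (unlit i s) c.
  apply: supp_inD; first exact: supp_in_one.
  by apply: supp_inN; apply: supp_in_half_sum; [exact: unlit1 | exact: unlit_z].
have hl (i j : int) s s' : s' != s -> supp_in (unlit i s) (half_sum (lamp j s')).
  by move=> ss'; apply: supp_in_half_lamp; rewrite xpair_eqE (negPf ss') andbF.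
have tc : gr_tr c = 1 / 2.
  rewrite raddfB /= -gr_mono1 gr_tr_mono eqxx raddfD /= !gr_tr_mono eqxx.
  have /eqP/negPf -> := z_neq1.
  by rewrite addr0.
rewrite (mulrA (u 0)) (mulrA c) (mulrA c) tr_mul_chain => [|j].
  rewrite tr_half_sum; last by apply: supp_in_mulr; [exact: hc | apply: hl].
  rewrite tr_half_sum; last exact: hc.
  have -> : true%:R = 1 :> rat by [].
  have n0 : (2 : rat) ^+ n != 0 by rewrite expf_neq0.
  by rewrite tc !exprD; set x := 2 ^+ n in n0 *; field; rewrite n0.
by apply: supp_in_mulr; [apply: supp_in_mulr; [exact: hc | exact: hl] | exact: hl].
Qed.

Lemma gr_starK (x : Q) : gr_star (gr_star x) = x.
Proof.
rewrite {2}/gr_star gr_star_sum [RHS]gr_monoE; apply: eq_bigr => g _.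
by rewrite -/(gr_mono _ _) gr_star_mono invgK.
Qed.

Lemma gr_starB (x y : Q) : gr_star (x - y) = gr_star x - gr_star y.
Proof.
have starN : gr_star (- y) = - gr_star y.
  by apply/eqP; rewrite -addr_eq0 -gr_starD addNr gr_star0.
by rewrite gr_starD starN.
Qed.

(** Conditions at the origin are enough because translations move every position there. A break at
    -1 makes the origin the first position of its chain, a break at 0 the last one. *)
Definition defects : seq Q :=
  [:: 1 - c; a 0 * (1 - tz 1); (1 - a (-1)) * (1 - u 0); (1 - a 0) * (1 - w 0)].

Definition defect_laplacian : Q := \sum_(x <- defects) gr_star x * x.

Local Notation W := (proj_sum tz a u w c m eps).
Local Notation L := (long_chains a).

Section ChainFacts.

(* These hints and the local facts that follow let [//] discharge the hypotheses
   of the section [Chains]. *)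
#[local] Hint Resolve tz_zero tz_add c_idem c_central
  gr_star1 star_central_proj star_translation : core.

Let uwC : forall n : nat, eps n -> u 0 * w n%:Z = w n%:Z * u 0.
Proof. exact: u_w_comm. Qed.
Let uwN : forall n : nat, ~~ eps n ->
  c * ((u 0 *+ 2 - 1) * (w n%:Z *+ 2 - 1)) = - (c * ((w n%:Z *+ 2 - 1) * (u 0 *+ 2 - 1))).
Proof. exact: u_w_anticomm. Qed.
Let tz_a (k i : int) : tz k * a i = a (i + k) * tz k. Proof. exact: tz_half_sum. Qed.
Let tz_w (k i : int) : tz k * w i = w (i + k) * tz k. Proof. exact: tz_half_sum. Qed.
Let a_idem i : a i * a i = a i. Proof. exact: half_sum_lamp_idem. Qed.
Let u_idem i : u i * u i = u i. Proof. exact: half_sum_lamp_idem. Qed.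
Let w_idem i : w i * w i = w i. Proof. exact: half_sum_lamp_idem. Qed.
Let aC i j : a i * a j = a j * a i. Proof. exact: break_comm. Qed.
Let auC i j : a i * u j = u j * a i. Proof. exact: break_comm. Qed.
Let awC i j : a i * w j = w j * a i. Proof. exact: break_comm. Qed.
Let star_a i : gr_star (a i) = a i. Proof. exact: star_half_sum_lamp. Qed.
Let star_u i : gr_star (u i) = u i. Proof. exact: star_half_sum_lamp. Qed.
Let star_w i : gr_star (w i) = w i. Proof. exact: star_half_sum_lamp. Qed.
Let mC n x : m n * x = x * m n. Proof. exact: gr_invC. Qed.
Let mK n : n.+1%:R * m n = 1. Proof. exact: gr_invK. Qed.
Let star_m n : gr_star (m n) = m n. Proof. exact: gr_star_inv. Qed.


Lemma defect_laplacian_proj N : defect_laplacian * W N = 0.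
Proof.
have key x n : x \in defects -> x * chain_proj tz a u w c m eps n = 0.
  rewrite !inE => /or4P[] /eqP ->.
  - by apply: comm_c_proj.
  - by apply: shift_proj.
  - by apply: start_proj.
  - by apply: end_proj.
rewrite /defect_laplacian mulr_suml big_seq big1 // => x xd.
rewrite -(mulrA (gr_star x)); have -> : x * W N = 0; last exact: mulr0.
have -> : x * W N = \sum_(0 <= n < N) x * chain_proj tz a u w c m eps n.
  exact: mulr_sumr.
by rewrite big1 // => n _; exact: key.
Qed.


Lemma defects_left_ideal (V : zmodType) (phi : {additive Q -> V}) N :
  (forall x y, phi x = 0 -> phi (y * x) = 0) ->
  (forall x, x \in defects -> phi x = 0) ->
  phi (1 - W N - L N) = 0.
Proof.
move=> phiM phid.
have h k : (k < 4)%N -> phi (nth 0 defects k) = 0 by move=> k4; apply: phid; exact: mem_nth.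
apply: phi_proj_sum => //.
- exact: (h 0%N).
- exact: (h 1%N).
- exact: (h 2%N).
- exact: (h 3%N).
Qed.

Lemma star_proj_sum_mul N M : (N <= M)%N ->
  gr_star (W M - W N) * (W M - W N) = W M - W N.
Proof.
move=> NM; have -> : gr_star (W M - W N) = W M - W N.
  have sP K : gr_star (W K) = W K.
    by apply: star_proj_sum => //; [exact: gr_starD | exact: gr_starM].
  by rewrite (gr_starB (W M)) !sP.
by apply: proj_sum_diff_idem.
Qed.

Lemma star_long_chains_mul N :
  gr_star (L N) * L N = L N.
Proof.
have -> : gr_star (L N) = L N.
  by apply: star_long_chains => //; [exact: gr_starD | exact: gr_starM].
by apply: long_chains_idem.
Qed.

Lemma star_rest N :
  gr_star (1 - W N - L N) = 1 - W N - L N.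
Proof.
have sP K : gr_star (W K) = W K.
  by apply: star_proj_sum => //; [exact: gr_starD | exact: gr_starM].
have sL : gr_star (L N) = L N.
  by apply: star_long_chains => //; [exact: gr_starD | exact: gr_starM].
by rewrite (gr_starB (1 - W N)) (gr_starB 1) sP sL gr_star1.
Qed.

Lemma tr_proj_sum_diff N M : (N <= M)%N ->
  gr_tr (W M - W N) = \sum_(N <= n < M) (eps n)%:R / 2 ^+ (n + 5).
Proof.
move=> NM.
have -> : gr_tr (W M - W N) = \sum_(N <= n < M) gr_tr (corner n).
  by apply: tau_proj_sum => //; exact: gr_trC.
by apply: eq_bigr => n _; exact: tr_corner.
Qed.

(** There are n + 1 chains of n steps through the origin, each of trace 2^-(n+2); the formula is
    what they leave for n < N. It tends to 0: infinite chains have measure zero. *)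
Lemma tr_long_chains N : gr_tr (L N) = (N + 2)%:R / 2 ^+ N.+1.
Proof.
have -> : gr_tr (L N) = gr_tr (1 : Q) - \sum_(0 <= n < N) n.+1%:R * gr_tr (chain 0 n).
  exact: (tau_long_chains tz_zero tz_add tz_a (@gr_trC G)).
have -> : gr_tr (1 : Q) = 1 by rewrite -gr_mono1 gr_tr_mono eqxx.
elim: N => [|N IHN]; first by rewrite big_geq.
rewrite big_nat_recr //= opprD addrA IHN tr_chain !exprS exprD !natrD -!natr1.
have n0 : (2 : rat) ^+ N != 0 by rewrite expf_neq0.
set x := 2 ^+ N in n0 *; field; exact: n0.
Qed.

End ChainFacts.

Section Kernel.
Variable R : realType.

Definition gr_eval (v : G -> R[i]) (x : Q) : G -> R[i] := gr_act x v.

Lemma gr_eval_is_zmod_morphism v : zmod_morphism (gr_eval v).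
Proof. by move=> x y; exact: gr_actBl. Qed.

HB.instance Definition _ v :=
  GRing.isZmodMorphism.Build Q (G -> R[i]) (gr_eval v) (gr_eval_is_zmod_morphism v).

(** Pairing with v gives the sum of the squared norms of the B v, so all of them vanish. *)
Lemma defect_laplacian_kernel (v : G -> R[i]) x : l2 v -> gr_act defect_laplacian v = 0 ->
  x \in defects -> gr_act x v = 0.
Proof.
move=> vl Tv xd; have xl y : l2 (gr_act y v) by exact: l2_act.
have dotE (y : Q) : l2_dot (gr_act (gr_star y * y) v) v = l2_dot (gr_act y v) (gr_act y v).
  rewrite (gr_actM (gr_star y) y v).
  rewrite (gr_act_star (gr_star y) (xl y) vl).
  by rewrite (gr_starK y).
have sumE (r : seq Q) : l2_dot (gr_act (\sum_(y <- r) gr_star y * y) v) v =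
    \sum_(y <- r) l2_dot (gr_act y v) (gr_act y v).
  elim: r => [|y r IHr]; first by rewrite !big_nil gr_act0 l2_dot0l.
  by rewrite !big_cons gr_actDl l2_dotDl // dotE IHr.
have /eqP := sumE defects; rewrite -/defect_laplacian Tv l2_dot0l // eq_sym.
rewrite psumr_eq0 => [/allP/(_ x xd)/eqP|y _]; last by have [] := l2_dot_ge0 (xl y).
exact: l2_dot_eq0.
Qed.

Lemma ratr_eps N M : ratr (\sum_(N <= n < M) (eps n)%:R / 2 ^+ (n + 5)) =
  \sum_(N <= n < M) (eps n)%:R / 2 ^+ (n + 5) :> R.
Proof.
rewrite rmorph_sum; apply: eq_bigr => n _ /=.
by rewrite fmorph_div rmorphXn /= !ratr_nat.
Qed.

Lemma vn_dim_ker_defect_laplacian (rho : R) k :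
  (fun N => \sum_(0 <= n < N) (eps n)%:R / 2 ^+ (n + 5) : R) @ \oo --> rho ->
  @vn_dim_ker R G k defect_laplacian%:M = (rho *+ k)%:C%C.
Proof.
move=> epsrho.
(* Both rates are convenient geometric bounds: the tail of the terms 2^-(n+5) is below that of
   2^-(n+1), which telescopes to at most 2^-N, and (N + 2) / 2^(N+1) <= (3/4)^N by induction. *)
apply: (@vn_dim_ker_limit R G defect_laplacian W L
  (fun N => 2^-1 ^+ N) (fun N => (3 / 4) ^+ N) rho k).
- exact: defect_laplacian_proj.
- move=> N v vl Tv; rewrite star_rest.
  apply: (@defects_left_ideal _ (gr_eval v) N) => [x y h|x xd].
    have h' : gr_act x v = 0 := h.
    suff : gr_act (y * x) v = 0 by [].
    by rewrite gr_actM h' gr_actr0.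
  exact: defect_laplacian_kernel.
- move=> N M NM; rewrite (star_proj_sum_mul NM) -/(gr_tr _) (tr_proj_sum_diff NM) ratr_eps.
  apply: (@le_trans _ _ (\sum_(N <= n < M) (2^-1 ^+ n - 2^-1 ^+ n.+1))).
    apply: ler_sum => n _.
    have -> : 2^-1 ^+ n - 2^-1 ^+ n.+1 = 2^-1 ^+ n.+1 :> R.
      by rewrite exprS; set x := _ ^+ n; lra.
    rewrite exprVn ler_pdivrMr ?exprn_gt0 // mulrC -expfB; last lia.
    by apply: (@le_trans _ _ 1); [case: (eps n) | apply: exprn_ege1; rewrite ler1n].
  rewrite (eq_bigr (fun n : nat => - (2^-1 ^+ n.+1) - - (2^-1 ^+ n))); last first.
    by move=> n _; rewrite opprK addrC.
  rewrite telescope_sumr // opprK addrC lerBlDr lerDl exprn_ge0 //.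
- move=> N; rewrite star_long_chains_mul -/(gr_tr _) tr_long_chains.
  rewrite fmorph_div rmorphXn /= !ratr_nat ler_pdivrMr ?exprn_gt0 //.
  elim: N => [|N IHN]; first by rewrite expr0 mul1r expr1.
  rewrite addSn -natr1; move: IHN; rewrite !exprS.
  have : 1 <= (3 / 4) ^+ N * (2 * 2 ^+ N) :> R.
    rewrite mulrCA -exprMn; have -> : 3 / 4 * 2 = 3 / 2 :> R by lra.
    have h : 1 <= (3 / 2 : R) ^+ N by apply: exprn_ege1; lra.
    lra.
  rewrite natrD; have N0 : 0 <= N%:R :> R by [].
  set x := (3 / 4) ^+ N; set y := 2 ^+ N; move=> h1 h2.
  have -> : 3 / 4 * x * (2 * (2 * y)) = 3 / 2 * (x * (2 * y)) by lra.
  move: h1 h2; set t := x * (2 * y); move=> h1 h2; lra.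
- by apply: cvg_expr; rewrite ger0_norm ?invr_ge0 // invf_lt1 // ltr1n.
- by apply: cvg_expr; rewrite ger0_norm; lra.
rewrite (_ : (fun N => _) = (fun N => \sum_(0 <= n < N) (eps n)%:R / 2 ^+ (n + 5) : R)) //.
apply/funext => N; rewrite -ratr_eps -(tr_proj_sum_diff (leq0n N)).
have -> : W 0 = 0 by rewrite /proj_sum big_geq.
by rewrite subr0.
Qed.

End Kernel.
End LampElements.

(** * Binary digits and the realization of every nonnegative real *)

Lemma binary_expansion (R : realType) (x : R) : 0 <= x <= 1 ->
  exists eps : nat -> bool,
    (fun N => \sum_(0 <= n < N) (eps n)%:R / 2 ^+ n.+1 : R) @ \oo --> x.
Proof.
move=> /andP[x0 x1].
pose fix s n : R := if n is n'.+1 then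
  s n' + (s n' + (2 ^+ n'.+1)^-1 <= x)%R%:R / 2 ^+ n'.+1 else 0.
exists (fun n => s n + (2 ^+ n.+1)^-1 <= x).
have sE : (fun N => \sum_(0 <= n < N) (s n + (2 ^+ n.+1)^-1 <= x)%R%:R / 2 ^+ n.+1) = s.
  apply/funext; elim=> [|N IHN]; first by rewrite big_geq.
  by rewrite big_nat_recr //= IHN.
rewrite sE.
(* Invariant of the greedy choice of digits; its upper bound is not strict, so x = 1 is covered,
   with all digits 1. *)
have sb n : s n <= x <= s n + 2^-1 ^+ n.
  elim: n => [|n /andP[IH1 IH2]]; first by rewrite expr0 add0r x0 x1.
  have e : 2^-1 ^+ n = 2 * 2^-1 ^+ n.+1 :> R by rewrite exprS mulrA divff // mul1r.
  have t0 : 0 <= 2^-1 ^+ n.+1 :> R by rewrite exprn_ge0 // invr_ge0.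
  rewrite /= -exprVn; move: IH1 IH2 t0; rewrite e; set t := 2^-1 ^+ n.+1 => IH1 IH2 t0.
  by case: (lerP (s n + t) x) => /= h; rewrite ?mul1r ?mul0r; apply/andP; split; lra.
apply/cvgrPdist_le => e e0.
have /cvgrPdist_le/(_ e e0)[N _ hN] : (fun n => 2^-1 ^+ n : R) @ \oo --> (0 : R).
  by apply: cvg_expr; rewrite ger0_norm ?invr_ge0 // invf_lt1 // ltr1n.
exists N => // n Nn; have := hN n Nn; rewrite /= sub0r normrN ger0_norm; last first.
  by rewrite exprn_ge0 // invr_ge0.
move=> h; have /andP[s1 s2] := sb n; rewrite ger0_norm ?subr_ge0 //.
by apply: le_trans h; rewrite lerBlDl.
Qed.

Definition twisted_lamplighter (A : comNzRingType) (eps : nat -> bool) : groupType :=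
  tlamp_type A eps.

Lemma twisted_lamplighter_betti (A : comNzRingType) (eps : nat -> bool)
    (R : realType) (rho : R) k :
  1 + 1 = 0 :> A ->
  (fun N => \sum_(0 <= n < N) (eps n)%:R / 2 ^+ (n + 5) : R) @ \oo --> rho ->
  exists T : group_ring (twisted_lamplighter A eps),
    @vn_dim_ker R (twisted_lamplighter A eps) k T%:M = (rho *+ k)%:C%C.
Proof.
move=> A2 epsrho.
pose G := twisted_lamplighter A eps.
pose l (i : int) (s : option bool) : G := lamp A eps ((i, s) : site).
pose tr (n : int) : G := translation A eps n.
pose z : G := central_elt A eps.
pose off (i : int) (s : option bool) (g : G) : Prop := unlit ((i, s) : site) g.
have tr0 : tr 0 = 1%g by [].
have trD (n m : int) : tr (n + m) = (tr n * tr m)%g by exact: translationD.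
have trl (n i : int) s : (tr n * l i s = l (i + n)%R s * tr n)%g by exact: translation_lamp.
have ll i s : (l i s * l i s = 1)%g by apply: lampK => //; case: s => [[]|].
have lC i j s : (l i None * l j s = l j s * l i None)%g.
  by apply: lamp_comm; case: s => [[]|].
have zz : (z * z = 1)%g by exact: central_eltK.
have zC g : (z * g = g * z)%g by exact: central_eltC.
have z1 : z <> 1%g by exact: central_elt_neq1.
have se (n : nat) : eps n ->
    (l 0%R (Some false) * l n%:Z (Some true) = l n%:Z (Some true) * l 0%R (Some false))%g.
  by move=> en; apply: lamp_comm; rewrite twist_start_end en.
have seN (n : nat) : ~~ eps n ->
    (l 0%R (Some false) * l n%:Z (Some true) =
     z * (l n%:Z (Some true) * l 0%R (Some false)))%g.
  by move=> en; apply: lamp_anticomm => //; rewrite twist_start_end en.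
have offM i s g h : off i s g -> off i s h -> off i s (g * h)%g by exact: unlitM.
have offV i s g : off i s g -> off i s g^-1%g by exact: unlitV.
have off1 i s : off i s 1%g by exact: unlit1.
have offz i s : off i s z by exact: unlit_central.
have offl i s j s' : (j, s') != (i, s) -> off i s (l j s') by exact: unlit_lamp.
have onl i s : ~ off i s (l i s) by exact: lit_lamp.
exists (defect_laplacian l tr z).
exact: (vn_dim_ker_defect_laplacian tr0 trD trl ll lC zz zC z1 se seN offM offV off1 offz
  offl onl k epsrho).
Qed.

Theorem theorem1p3 (R : realType) :
  [set r : R | exists G : groupType,
     finitely_generated G /\ l2_betti_numbers R G r] = [set r : R | 0 <= r].
Proof.
apply/seteqP; split=> [r [G [_ /l2_betti_numbers_ge0]] //|r /= r0].
(* One group realizes dimensions up to 1/16, so r is divided by a matrix size k + 1 that brings 16 r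
   / (k + 1) into [0, 1]. *)
have [k rk] : exists k : nat, 16 * r <= k.+1%:R.
  have rk := archi_boundP (mulr_ge0 (ler0n R 16) r0).
  by exists (Num.bound (16 * r)); apply: le_trans (ltW rk) _; rewrite ler_nat.
have k0 : 0 < k.+1%:R :> R by rewrite ltr0n.
have [|eps epsx] := @binary_expansion R (16 * r / k.+1%:R).
  by rewrite divr_ge0 ?mulr_ge0 ?(ltW k0) //= ler_pdivrMr // mul1r.
have A2 : 1 + 1 = 0 :> 'F_2 by apply/val_inj.
have A01 (x : 'F_2) : x = 0 \/ x = 1.
  by case: x => [[|[|i]] lti] //; [left|right]; apply: val_inj.
exists (twisted_lamplighter 'F_2 eps); split; first exact: tlamp_finitely_generated A01.
(* Since 2^(n+5) = 16 * 2^(n+1), the digits of 16 r / (k + 1) give r / (k + 1) as the sum of the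
   traces; the matrix size restores r. *)
have [|T dimT] := @twisted_lamplighter_betti 'F_2 eps R (r / k.+1%:R) k.+1 A2.
  have -> : r / k.+1%:R = (16 * r / k.+1%:R) * 16^-1.
    by move: (lt0r_neq0 k0); set K := k.+1%:R => K0; field.
  rewrite (_ : (fun N => _) = (fun N => (\sum_(0 <= n < N) (eps n)%:R / 2 ^+ n.+1) * 16^-1)).
    by apply: cvgMl.
  apply/funext => N; rewrite mulr_suml; apply: eq_bigr => n _.
  rewrite -mulrA -invfM; congr (_ / _); rewrite -addSnnS exprD; congr (_ * _); ring.
exists k.+1, T%:M; split=> //; rewrite dimT; congr _%:C%C.
by rewrite -(mulr_natr (r / _)) divfK // pnatr_eq0.
Qed.
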